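(* Let $\eta\in\mathbb{C}$, $N\in\mathbb{N}^*$, $R_{a,b}(\lambda)=\lambda I_{a,b}+\eta\mathbb{P}_{a,b}$ on $\mathbb{C}^3\otimes\mathbb{C}^3$, let $K$ be a $w$-simple $3\times3$ matrix, let $\xi_1,\dots,\xi_N$ satisfy $\xi_a\neq\xi_b+r\eta$ for all $a\neq b$, $r\in\{-2,-1,0,1,2\}$, let $\mathcal{H}=(\mathbb{C}^3)^{\otimes N}$ and $T_1^{(K)}(\lambda)=\operatorname{tr}_a\big(K_aR_{a,N}(\lambda-\xi_N)\cdots R_{a,1}(\lambda-\xi_1)\big)$. Let $\langle S|\in\mathcal{H}^*$ be such that $\langle h_1,\dots,h_N|:=\langle S|\prod_{n=1}^N(T_1^{(K)}(\xi_n))^{h_n}$, $(h_1,\dots,h_N)\in\{0,1,2\}^N$, is a basis of $\mathcal{H}^*$. Define $g_a(\lambda)=\prod_{b\neq a}\frac{\lambda-\xi_b}{\xi_a-\xi_b}$, $f_a(\lambda)=\prod_{b\neq a}\frac{\lambda-\xi_b+\eta}{\xi_a-\xi_b}\prod_{b=1}^N\frac{\lambda-\xi_b}{\xi_a-\eta-\xi_b}$, $T_2^{\infty}(\lambda)=\frac{(\operatorname{tr}K)^2-\operatorname{tr}K^2}{2}\prod_{n=1}^N(\lambda-\xi_n)(\lambda-\xi_n+\eta)$, and $q(\lambda)=\det K\prod_{b=1}^N(\lambda-\xi_b)(\lambda+\eta-\xi_b)(\lambda+3\eta-\xi_b)$. Then the set of eigenvalues of $T_1^{(K)}(\lambda)$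 is $$\Sigma_{T^{(K)}}=\Big\{t_1(\lambda)=\operatorname{tr}K\prod_{a=1}^N(\lambda-\xi_a)+\sum_{a=1}^Ng_a(\lambda)x_a:(x_1,\dots,x_N)\in\Sigma_T\Big\},$$ where $\Sigma_T$ is the set of solutions $(x_1,\dots,x_N)$ of the $N$ cubic equations $$x_a\Big[T_2^{\infty}(\xi_a-2\eta)+\sum_{n=1}^Nf_n(\xi_a-2\eta)\,t_1(\xi_n-\eta)\,x_n\Big]=q(\xi_a-2\eta),\qquad a=1,\dots,N,$$ with $t_1(\lambda)=\operatorname{tr}K\prod_a(\lambda-\xi_a)+\sum_ag_a(\lambda)x_a$. Moreover $T_1^{(K)}(\lambda)$ is $w$-simple, and for every $t_1\in\Sigma_{T^{(K)}}$ the associated unique (up to normalization) eigenvector $|t\rangle$ satisfies $\langle h_1,\dots,h_N|t\rangle=\prod_{n=1}^Nt_1(\xi_n)^{h_n}$.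
   Context: $w$-simple for the commuting family $T_1^{(K)}(\lambda)$ means each eigenvalue function has exactly one common eigenvector up to scalar. $q(\lambda)$ is the quantum determinant of the monodromy matrix $K_aR_{a,N}(\lambda-\xi_N)\cdots R_{a,1}(\lambda-\xi_1)$. *)

(* Defs.v *)
From HB Require Import structures.
From mathcomp Require Import all_boot all_order all_algebra.
From mathcomp Require Import complex.
From mathcomp Require Import reals.
Set Implicit Arguments. Unset Strict Implicit. Unset Printing Implicit Defensive.
Import Order.TTheory GRing.Theory Num.Theory.
Local Open Scope ring_scope.

Section Defs.
Variable (C : fieldType).

(* Spin configurations on N sites: basis of H = (C^3)^{(x)N}. *)
Definition cfgT (N : nat) := {ffun 'I_N -> 'I_3}.
Definition Hdim (N : nat) := #|cfgT N|.
Definition cfg (N : nat) (i : 'I_(Hdim N)) : cfgT N := enum_val i.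

(* elementary operator e_{ab} acting on site n : |i> <- |j> *)
Definition Eop (N : nat) (n : 'I_N) (a b : 'I_3) : 'M[C]_(Hdim N) :=
  \matrix_(i, j) ((cfg i n == a) && (cfg j n == b)
                  && [forall m, (m != n) ==> (cfg i m == cfg j m)])%:R.

(* R_{a,n}(mu) = mu I + eta P_{a,n}, as a 3x3 auxiliary matrix with operator
   entries: P_{a,n} = sum_{g,d} e^{(a)}_{g d} (x) e^{(n)}_{d g}. *)
Definition Lop (N : nat) (eta : C) (n : 'I_N) (mu : C) : 'M['M[C]_(Hdim N)]_3 :=
  \matrix_(g, d) ((mu * (g == d)%:R)%:M + eta *: Eop n d g).

Definition Kop (N : nat) (K : 'M[C]_3) : 'M['M[C]_(Hdim N)]_3 :=
  \matrix_(g, d) (K g d)%:M.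

Definition T1 (N : nat) (eta : C) (K : 'M[C]_3) (xi : 'I_N -> C) (l : C)
  : 'M[C]_(Hdim N) :=
  \tr (Kop N K *m \prod_(n < N) Lop eta (rev_ord n) (l - xi (rev_ord n))).

Definition hvec (N : nat) (eta : C) (K : 'M[C]_3) (xi : 'I_N -> C)
  (S : 'rV[C]_(Hdim N)) (h : cfgT N) : 'rV[C]_(Hdim N) :=
  S *m \prod_(n < N) (T1 eta K xi (xi n)) ^+ (h n).

Definition hmx (N : nat) (eta : C) (K : 'M[C]_3) (xi : 'I_N -> C)
  (S : 'rV[C]_(Hdim N)) : 'M[C]_(Hdim N) :=
  \matrix_(i < Hdim N) hvec eta K xi S (cfg i).

Definition is_common_eigvec (d : nat) (T : C -> 'M[C]_d) (t : C -> C)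
  (v : 'cV[C]_d) : Prop :=
  v != 0 /\ forall l, T l *m v = t l *: v.

Definition family_eigenvalue (d : nat) (T : C -> 'M[C]_d) (t : C -> C) : Prop :=
  exists v, is_common_eigvec T t v.

Definition wsimple_family (d : nat) (T : C -> 'M[C]_d) : Prop :=
  forall t v w, is_common_eigvec T t v -> is_common_eigvec T t w ->
    exists c : C, w = c *: v.

Definition wsimple_mx (n : nat) (K : 'M[C]_n) : Prop :=
  forall a, eigenvalue K a -> \rank (eigenspace K a) = 1%N.

Definition gfun (N : nat) (xi : 'I_N -> C) (a : 'I_N) (l : C) : C :=
  \prod_(b < N | b != a) ((l - xi b) / (xi a - xi b)).

Definition ffun_ (N : nat) (eta : C) (xi : 'I_N -> C) (a : 'I_N) (l : C) : C :=
  (\prod_(b < N | b != a) ((l - xi b + eta) / (xi a - xi b)))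
  * \prod_(b < N) ((l - xi b) / (xi a - eta - xi b)).

Definition T2inf (N : nat) (eta : C) (K : 'M[C]_3) (xi : 'I_N -> C) (l : C) : C :=
  ((\tr K) ^+ 2 - \tr (K *m K)) / 2%:R
  * \prod_(n < N) ((l - xi n) * (l - xi n + eta)).

Definition qdet (N : nat) (eta : C) (K : 'M[C]_3) (xi : 'I_N -> C) (l : C) : C :=
  \det K * \prod_(b < N) ((l - xi b) * (l + eta - xi b) * (l + 3%:R * eta - xi b)).

Definition t1of (N : nat) (K : 'M[C]_3) (xi : 'I_N -> C) (x : 'I_N -> C) (l : C) : C :=
  \tr K * \prod_(a < N) (l - xi a) + \sum_(a < N) gfun xi a l * x a.

Definition in_SigmaT (N : nat) (eta : C) (K : 'M[C]_3) (xi : 'I_N -> C)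
  (x : 'I_N -> C) : Prop :=
  forall a : 'I_N,
    x a * (T2inf eta K xi (xi a - 2%:R * eta)
           + \sum_(n < N) ffun_ eta xi n (xi a - 2%:R * eta)
                          * t1of K xi x (xi n - eta) * x n)
    = qdet eta K xi (xi a - 2%:R * eta).

End Defs.

(* Main.v *)
Require Import Defs.
From HB Require Import structures.
From mathcomp Require Import all_boot all_order all_algebra.
From mathcomp Require Import complex.
From mathcomp Require Import reals.
From mathcomp Require Import ring zify.
Import Order.TTheory GRing.Theory Num.Theory.
Local Open Scope ring_scope.
Set Implicit Arguments. Unset Strict Implicit. Unset Printing Implicit Defensive.

(** The RTT relations give the fusion identities: with
    [T2(l) = (T1(l) T1(l + eta) - tr (M(l) M(l + eta))) / 2], one has
    [T2(xi_a) = 0], [T2(xi_a - eta) = T1(xi_a - eta) T1(xi_a)] and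
    [T2(xi_a - 2 eta) T1(xi_a) = q(xi_a - 2 eta)].  Interpolating [T2] turns
    them into the cubic system for the commuting operators [T1(xi_a)], hence
    for their eigenvalues; the basis property makes each joint eigenvector
    unique and gives its coordinates.

    Conversely, a solution [x] of the cubic system gives a second representation
    [T1(xi_a) |-> x_a] of the same relations, and one needs that every
    polynomial in commuting elements satisfying them is a combination of the
    [3^N] monomials with exponents at most 2.  Modulo lower degrees, let [y] and
    [s] be the leading parts of [t1] and [T2 / prod_b (l - xi_b)], polynomials
    of degree less than [N] in [l].  The relations become
    [x_a s(xi_a - 2 eta) = 0] and [s(xi_a - eta) = x_a y(xi_a - eta)] up to a
    scalar.  Filtering for every [a] by whether [x_a] or [s(xi_a - 2 eta)] is
    killed forces [s] to vanish at [N] distinct points, so [s = 0]; filtering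
    the relations [x_a y(xi_a - eta) = 0] that are left in the same way forces
    [y = 0].  Each successive choice contributes a factor [1], [x_a] or
    [x_a^2]. *)

(** * Vector-valued polynomial functions *)

Lemma gfun_node (C : fieldType) N (z : 'I_N -> C) i j : injective z ->
  gfun z i (z j) = (i == j)%:R.
Proof.
move=> zi; rewrite /gfun; have [<-|ij] := eqVneq i j.
  by rewrite big1 // => k ki; rewrite divff // subr_eq0 inj_eq // eq_sym.
by rewrite (bigD1 j) /= 1?eq_sym // subrr !mul0r.
Qed.

Section PolynomialFunctions.
Variables (C : fieldType) (V : lmodType C).
Implicit Types (f g : C -> V) (c : V).

(** Horner form of a polynomial function of degree at most [d]. The parameter [c] is the coefficient
    of degree exactly [d], so [c = 0] expresses degree less than [d]. *)
Fixpoint polyfun (d : nat) (c : V) (f : C -> V) : Prop :=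
  if d is d'.+1 then
    exists g c0, polyfun d' c g /\ forall l, f l = l *: g l + c0
  else forall l, f l = c.

Lemma polyfun_eq d c f g : f =1 g -> polyfun d c f -> polyfun d c g.
Proof.
case: d => [|d] fg /=; first by move=> fc l; rewrite -fg.
by move=> [h [c0 [hd fE]]]; exists h, c0; split=> // l; rewrite -fg.
Qed.

Lemma polyfunD d c c' f g : polyfun d c f -> polyfun d c' g ->
  polyfun d (c + c') (fun l => f l + g l).
Proof.
elim: d c c' f g => [|d IH] c c' f g /=; first by move=> fc gc l; rewrite fc gc.
move=> [f1 [c0 [f1d fE]]] [g1 [c1 [g1d gE]]].
exists (fun l => f1 l + g1 l), (c0 + c1); split; first exact: IH.
by move=> l; rewrite fE gE scalerDr addrACA.
Qed.

Lemma polyfunZ d c f a : polyfun d c f -> polyfun d (a *: c) (fun l => a *: f l).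
Proof.
elim: d c f => [|d IH] c f /=; first by move=> fc l; rewrite fc.
move=> [f1 [c0 [f1d fE]]]; exists (fun l => a *: f1 l), (a *: c0); split; first exact: IH.
by move=> l; rewrite fE scalerDr !scalerA mulrC.
Qed.

Lemma polyfunS d c f : polyfun d c f -> polyfun d.+1 0 f.
Proof.
elim: d c f => [|d IH] c f.
  by move=> /= fc; exists (fun=> 0), c; split=> // l; rewrite fc scaler0 add0r.
by move=> [f1 [c0 [f1d fE]]]; exists f1, c0; split=> //; apply: IH f1d.
Qed.

Lemma polyfun0 d : polyfun d 0 (fun=> 0).
Proof. by elim: d => [//|d IH]; apply: polyfunS IH. Qed.

Lemma polyfun_sum d (I : Type) (s : seq I) (P : pred I) (c : I -> V) (f : I -> C -> V) :
  (forall i, P i -> polyfun d (c i) (f i)) ->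
  polyfun d (\sum_(i <- s | P i) c i) (fun l => \sum_(i <- s | P i) f i l).
Proof.
move=> fd; elim: s => [|i s IH].
  by rewrite big_nil; apply: polyfun_eq (polyfun0 d) => l; rewrite big_nil.
rewrite big_cons; case: ifP => Pi.
  apply: polyfun_eq (polyfunD (fd i Pi) IH) => l.
  by rewrite big_cons Pi.
by apply: polyfun_eq IH => l; rewrite big_cons Pi.
Qed.

Lemma polyfun_cst d (v : V) : polyfun d.+1 0 (fun=> v).
Proof. by elim: d => [|d IH]; [exact: (@polyfunS 0 v) | exact: polyfunS IH]. Qed.

Lemma polyfun_affine d c f a b : polyfun d c f ->
  polyfun d.+1 (a *: c) (fun l => (a * l + b) *: f l).
Proof.
elim: d c f => [|d IH] c f.
  move=> fc; exists (fun=> a *: c), (b *: c); split=> //= l.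
  by rewrite fc scalerDl scalerA (mulrC l).
move=> [f1 [c0 [f1d fE]]].
exists (fun l => (a * l + b) *: f1 l + a *: c0), (b *: c0); split.
  rewrite -[a *: c]addr0; apply: polyfunD; [exact: IH | exact: polyfun_cst].
move=> l; rewrite fE !scalerDr [(_ + b) *: c0]scalerDl !scalerA addrA.
by rewrite [l * (_ + b)]mulrC [l * a]mulrC.
Qed.

Lemma polyfun_shift d c f a : polyfun d c f -> polyfun d c (fun l => f (l + a)).
Proof.
elim: d c f => [|d IH] c f; first by move=> fc l; rewrite fc.
move=> [f1 [c0 [f1d fE]]]; have g1d := IH _ _ f1d.
have := polyfunD (polyfun_affine 1 a g1d) (polyfun_cst d c0).
rewrite scale1r addr0; apply: polyfun_eq => l.
by rewrite fE mul1r.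
Qed.

(** Synthetic division: the quotient is built along the Horner form, and its top coefficient is that
    of [f]. *)
Lemma polyfun_div d c f z : polyfun d.+1 c f ->
  exists2 g, polyfun d c g & forall l, f l = (l - z) *: g l + f z.
Proof.
elim: d c f => [|d IH] c f [f1 [c0 [f1d fE]]].
  by exists f1 => // l; rewrite !fE !f1d scalerBl addrA subrK.
have [g1 g1d g1E] := IH _ _ f1d.
exists (fun l => l *: g1 l + f1 z); first by exists g1, (f1 z).
move=> l; rewrite !fE (g1E l) !scalerDr !scalerA !scalerBl addrA mulrC.
by rewrite -!addrA addKr.
Qed.

(** The roots are divided out one at a time; since they are distinct, each remaining one is still a
    root of the quotient. *)
Lemma polyfun_zeros d c f (s : seq C) : uniq s -> (forall z, z \in s -> f z = 0) ->
  polyfun (size s + d) c f ->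
  exists2 g, polyfun d c g & forall l, f l = (\prod_(z <- s) (l - z)) *: g l.
Proof.
elim: s f => [|z s IH] f /=; first by move=> _ _ fd; exists f => // l; rewrite big_nil scale1r.
move=> /andP[zs us] f0 /(polyfun_div z)[g gd gE].
have fz : f z = 0 by apply: f0; rewrite mem_head.
have [y ys|h hd hE] := IH g us _ gd.
  have := gE y; rewrite fz addr0 f0 ?inE ?ys ?orbT // => /esym/eqP.
  rewrite scaler_eq0 subr_eq0 => /orP[/eqP yz|/eqP//].
  by rewrite -yz ys in zs.
by exists h => // l; rewrite big_cons gE fz addr0 hE scalerA.
Qed.

Lemma polyfun_prod_affine (I : Type) (s : seq I) (a b : I -> C) d c f :
  polyfun d c f ->
  polyfun (size s + d) ((\prod_(i <- s) a i) *: c)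
    (fun l => (\prod_(i <- s) (a i * l + b i)) *: f l).
Proof.
move=> fd; elim: s => [|i s IH] /=.
  by rewrite big_nil scale1r; apply: polyfun_eq fd => l; rewrite big_nil scale1r.
rewrite big_cons -scalerA; apply: polyfun_eq (polyfun_affine _ (b i) IH) => l.
by rewrite big_cons scalerA.
Qed.

(** There are only [N - 1] affine factors, so the coefficient of degree [N] is 0. *)
Lemma polyfun_gfun N (z : 'I_N -> C) i (v : V) : polyfun N 0 (fun l => gfun z i l *: v).
Proof.
have sz : size (enum (predC1 i)) = N.-1 by rewrite -cardE cardC1 card_ord.
have N0 : (0 < N)%N by case: N i {z sz} => // -[].
have := polyfun_prod_affine (enum (predC1 i)) (fun j => (z i - z j)^-1)
  (fun j => - z j / (z i - z j)) (d := 0) (c := v) (f := fun=> v) (fun=> erefl).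
move=> /polyfunS; rewrite addn0 sz prednK //; apply: polyfun_eq => l.
rewrite big_enum /=; congr (_ *: _); apply: eq_bigr => j _.
by rewrite mulrBl mulrC mulNr.
Qed.

(** Lagrange interpolation with a leading term: [f] minus its interpolant vanishes at the [N] nodes
    and keeps the top coefficient [c], because the interpolant has degree less than [N]. The
    quotient by the nodal product is therefore the constant [c]. *)
Lemma polyfun_interpolate N (z : 'I_N -> C) c f : injective z -> polyfun N c f ->
  forall l, f l = (\prod_(i < N) (l - z i)) *: c + \sum_(i < N) gfun z i l *: f (z i).
Proof.
move=> zi fd l.
pose h l := f l + - 1 *: \sum_(i < N) gfun z i l *: f (z i).
have hd : polyfun (size [seq z i | i <- enum 'I_N] + 0) c h.
  rewrite size_map size_enum_ord addn0.
  have := @polyfun_sum N _ (index_enum 'I_N) xpredT _ _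
    (fun i _ => polyfun_gfun z i (f (z i))).
  by rewrite big1 // => /(polyfunZ (- 1))/(polyfunD fd); rewrite scaler0 addr0.
have [||g gd hE] := polyfun_zeros _ _ hd.
- by rewrite map_inj_uniq ?enum_uniq.
- move=> _ /mapP[j _ ->].
  rewrite /h (bigD1 j) //= gfun_node // eqxx scale1r big1 ?addr0 ?scaleN1r ?subrr //.
  by move=> i ij; rewrite gfun_node // (negPf ij) scale0r.
have := hE l; rewrite /h gd scaleN1r big_map big_enum /= => /eqP.
by rewrite subr_eq => /eqP.
Qed.
End PolynomialFunctions.

Lemma polyfun_linear (C : fieldType) (V W : lmodType C) (phi : {linear V -> W}) d c f :
  polyfun d c f -> polyfun d (phi c) (phi \o f).
Proof.
elim: d c f => [|d IH] c f /=; first by move=> fc l; rewrite fc.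
move=> [g [c0 [gd fE]]]; exists (phi \o g), (phi c0); split; first exact: IH.
by move=> l; rewrite fE linearD linearZ.
Qed.

Lemma polyfun_mulmx (C : fieldType) D d e (c c' : 'M[C]_D) f g :
  polyfun d c f -> polyfun e c' g -> polyfun (d + e) (c * c') (fun l => f l * g l).
Proof.
elim: d c f => [|d IH] c f.
  move=> fc ge; apply: polyfun_eq (polyfun_linear (mulmx c) ge) => l /=.
  by rewrite fc.
move=> [f1 [c0 [f1d fE]]] ge; rewrite addSn.
have := polyfun_affine 1 0 (IH _ _ f1d ge); rewrite scale1r => h.
have k : polyfun (d + e).+1 0 (fun l => c0 * g l).
  have {}ge := polyfun_linear (mulmx c0) ge.
  elim: (d) => [|k ]; [exact: polyfunS ge | by rewrite addSn; exact: polyfunS].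
have := polyfunD h k; rewrite addr0; apply: polyfun_eq => l.
by rewrite fE mulrDl mul1r addr0; congr (_ + _); rewrite /GRing.mul /= scalemxAl.
Qed.

(** * Exchange relations and fusion *)

Section YangBaxter.
Variables (C : numFieldType) (D : nat).
Local Notation A := 'M[C]_D.
Implicit Types (X Y Z : 'M[A]_3) (a : C) (w v : A).

Lemma scale_mull a w v : a *: (w * v) = a *: w * v.
Proof. exact: scalemxAl. Qed.

Lemma scale_mulr a w v : a *: (w * v) = w * (a *: v).
Proof. exact: scalemxAr. Qed.

Lemma double_eq0 w : w = - w -> w = 0.
Proof.
move=> /eqP; rewrite -subr_eq0 opprK -mulr2n -scaler_nat scaler_eq0 pnatr_eq0.
by move=> /eqP.
Qed.

(** Holds for operators acting on different sites. *)
Definition entries_comm X Y := forall i j k l, X i j * Y k l = Y k l * X i j.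

Lemma entries_comm_mull X X' Y :
  entries_comm X Y -> entries_comm X' Y -> entries_comm (X * X') Y.
Proof.
move=> c c' i j k l; rewrite !mxE mulr_suml mulr_sumr; apply: eq_bigr => m _.
by rewrite -mulrA c' mulrA c mulrA.
Qed.

Lemma entries_comm_sym X Y : entries_comm X Y -> entries_comm Y X.
Proof. by move=> c i j k l; rewrite c. Qed.

Lemma entries_comm1 X : entries_comm 1 X.
Proof. by move=> i j k l; rewrite !mxE; case: eqP => _; rewrite ?mul1r ?mulr1 ?mul0r ?mulr0. Qed.

Lemma mul_entries2 X X' Y Y' i j k l : entries_comm X' Y ->
  (X * X') i j * (Y * Y') k l =
  \sum_m \sum_p (X i m * Y k p) * (X' m j * Y' p l).
Proof.
move=> c; rewrite !mxE mulr_suml; apply: eq_bigr => m _.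
rewrite mulr_sumr; apply: eq_bigr => p _.
by rewrite -!mulrA [X' m j * (Y k p * _)]mulrA c -mulrA.
Qed.

(** Exchanging the two summation indices changes the sign of the sum. *)
Lemma sum_antisym (w u : 'I_3 -> 'I_3 -> A) :
  (forall m p, w m p = - w p m) -> (forall m p, u m p = u p m) ->
  \sum_m \sum_p w m p * u m p = 0.
Proof.
move=> wa us; apply: double_eq0; rewrite [LHS]exchange_big -sumrN.
apply: eq_bigr => m _; rewrite -sumrN; apply: eq_bigr => p _.
by rewrite wa us mulNr.
Qed.

(* The component form of [(u + eta P) X_1 Y_2 = Y_2 X_1 (u + eta P)]. *)
Definition rtt (eta u : C) X Y := forall i j k l,
  u *: (X i j * Y k l) + eta *: (X k j * Y i l)
  = u *: (Y k l * X i j) + eta *: (Y k j * X i l).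

(** Train argument: $X_1X'_1Y_2Y'_2=(X_1Y_2)(X'_1Y'_2)$ by commutation, and $u+\eta P$ is carried
    through one pair and then the other. $P$ acts by swapping the summation indices [m] and [p]. *)
Lemma rtt_mul eta u X Y X' Y' :
  entries_comm X' Y -> entries_comm X Y' ->
  rtt eta u X Y -> rtt eta u X' Y' -> rtt eta u (X * X') (Y * Y').
Proof.
move=> c c' r r' i j k l.
have c'' := entries_comm_sym c'.
have lin a b (F G : 'I_3 -> 'I_3 -> A) :
    a *: (\sum_m \sum_p F m p) + b *: (\sum_m \sum_p G m p)
    = \sum_m \sum_p (a *: F m p + b *: G m p).
  rewrite !scaler_sumr -big_split; apply: eq_bigr => m _.
  by rewrite !scaler_sumr -big_split.
rewrite !mul_entries2 // !lin.
transitivity (\sum_m \sum_p (Y k p * X i m)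
              * (u *: (X' m j * Y' p l) + eta *: (X' p j * Y' m l))).
  transitivity (\sum_m \sum_p ((u *: (Y k p * X i m) + eta *: (Y k m * X i p))
                               * (X' m j * Y' p l))).
    by apply: eq_bigr => m _; apply: eq_bigr => p _; rewrite -r mulrDl !scale_mull.
  under eq_bigr => m _ do under eq_bigr => p _ do rewrite mulrDl.
  under [RHS]eq_bigr => m _ do under eq_bigr => p _ do rewrite mulrDr.
  under eq_bigr => m _ do rewrite big_split.
  under [RHS]eq_bigr => m _ do rewrite big_split.
  rewrite !big_split; congr (_ + _).
    by apply: eq_bigr => m _; apply: eq_bigr => p _; rewrite -scale_mull scale_mulr.
  rewrite exchange_big; apply: eq_bigr => m _; apply: eq_bigr => p _.
  by rewrite -scale_mull scale_mulr.
rewrite exchange_big; apply: eq_bigr => p _; apply: eq_bigr => m _.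
by rewrite r' mulrDr !scale_mulr.
Qed.

(* [P^- X_1 Y_2 P^+ = 0], [X_1 Y_2 P^+ = 0] and [P^- X_1 Y_2 = 0], for the
   (anti)symmetrizers [P^+-] of the two auxiliary spaces. *)
Definition fused X Y := forall i j k l,
  X i j * Y k l + X i l * Y k j = X k j * Y i l + X k l * Y i j.
Definition right_anti X Y := forall i j k l, X i j * Y k l = - (X i l * Y k j).
Definition left_sym X Y := forall i j k l, X i j * Y k l = X k j * Y i l.

(** At $u=-\eta$ the intertwiner is $-2\eta P^-$. The relation then equates two expressions, the
    right one being antisymmetric in the column indices; adding its copy with [j] and [l] exchanged
    cancels that side. *)
Lemma rtt_fused eta X Y : eta != 0 -> rtt eta (- eta) X Y -> fused X Y.
Proof.
move=> e0 r i j k l.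
have skew j' l' : X i j' * Y k l' - X k j' * Y i l' = Y k l' * X i j' - Y k j' * X i l'.
  apply: (scalerI e0); rewrite !scalerBr; apply: oppr_inj.
  by rewrite !opprB ![_ - _]addrC -!scaleNr.
have /eqP := congr2 +%R (skew j l) (skew l j).
rewrite [X in _ == X]addrA subrK subrr addrACA -opprD subr_eq0 => /eqP->.
by [].
Qed.

(** Antisymmetry produced in the rows is transmitted by $X_1Y_2$ to the inner indices, where it
    meets the symmetry of $X'_1Y'_2P^+$. *)
Lemma fused_mul X Y X' Y' : entries_comm X' Y ->
  fused X Y -> fused X' Y' -> fused (X * X') (Y * Y').
Proof.
move=> c f f' i j k l; rewrite !mul_entries2 //.
have add (F G : 'I_3 -> 'I_3 -> A) : \sum_m \sum_p F m p + \sum_m \sum_p G m p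
    = \sum_m \sum_p (F m p + G m p).
  by rewrite -big_split; apply: eq_bigr => m _; rewrite -big_split.
rewrite !add; apply/eqP; rewrite -subr_eq0 -sumrB; apply/eqP.
under eq_bigr => m _ do rewrite -sumrB.
under eq_bigr => m _ do under eq_bigr => p _ do rewrite -!mulrDr -mulrBl.
apply: sum_antisym => m p; last by rewrite f'.
by rewrite opprB; apply/eqP; rewrite subr_eq addrAC eq_sym subr_eq f addrC.
Qed.

(** By fusion $X'_1Y'_2P^+=P^+X'_1Y'_2P^+$, and $X_1Y_2P^+=0$. *)
Lemma right_anti_mulr X Y X' Y' : entries_comm X' Y ->
  right_anti X Y -> fused X' Y' -> right_anti (X * X') (Y * Y').
Proof.
move=> c a f i j k l; apply/eqP; rewrite -addr_eq0 !mul_entries2 //.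
rewrite -big_split /=.
under eq_bigr => m _ do rewrite -big_split /=.
under eq_bigr => m _ do under eq_bigr => p _ do rewrite -mulrDr.
by apply/eqP/sum_antisym => m p; [rewrite a | rewrite f].
Qed.

Lemma right_anti_mull X Y X' Y' : entries_comm X' Y ->
  right_anti X' Y' -> right_anti (X * X') (Y * Y').
Proof.
move=> c a i j k l; rewrite !mul_entries2 // -sumrN; apply: eq_bigr => m _.
by rewrite -sumrN; apply: eq_bigr => p _; rewrite a mulrN.
Qed.

Lemma left_sym_mulr X Y X' Y' : entries_comm X' Y ->
  left_sym X Y -> left_sym (X * X') (Y * Y').
Proof.
move=> c s i j k l; rewrite !mul_entries2 //; apply: eq_bigr => m _.
by apply: eq_bigr => p _; rewrite s.
Qed.

(** By fusion $P^-X_1Y_2=P^-X_1Y_2P^-$, and $P^-X'_1Y'_2=0$. *)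
Lemma left_sym_mull X Y X' Y' : entries_comm X' Y ->
  fused X Y -> left_sym X' Y' -> left_sym (X * X') (Y * Y').
Proof.
move=> c f s i j k l; apply/eqP; rewrite -subr_eq0 !mul_entries2 // -sumrB.
under eq_bigr => m _ do rewrite -sumrB.
under eq_bigr => m _ do under eq_bigr => p _ do rewrite -mulrBl.
apply/eqP/sum_antisym => m p; last by rewrite s.
by rewrite opprB; apply/eqP; rewrite subr_eq addrAC eq_sym subr_eq f addrC.
Qed.

(** Two contractions of the relation, the plain trace and the one twisted by $P$, give $ua=-\eta b$
    and $ub=-\eta a$, where $a$ is the commutator of the traces. Hence $(u^2-\eta^2)a=0$. *)
Lemma rtt_tr_comm eta u X Y : u ^+ 2 != eta ^+ 2 -> rtt eta u X Y ->
  \tr X * \tr Y = \tr Y * \tr X.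
Proof.
move=> ue r.
pose a := \tr X * \tr Y - \tr Y * \tr X.
pose b := \sum_i \sum_k (X k i * Y i k) - \sum_i \sum_k (Y k i * X i k).
have b' : b = \sum_i \sum_k (X i k * Y k i) - \sum_i \sum_k (Y k i * X i k).
  by rewrite /b exchange_big.
have aE : a = \sum_i \sum_k (X i i * Y k k) - \sum_i \sum_k (Y k k * X i i).
  by rewrite /a /mxtrace -!big_distrlr [X in _ = _ - X]exchange_big /= -big_distrlr.
have lin (F G H K : 'I_3 -> 'I_3 -> A) : (forall i k, u *: F i k + eta *: G i k
    = u *: H i k + eta *: K i k) ->
    u *: (\sum_i \sum_k F i k - \sum_i \sum_k H i k)
    = - (eta *: (\sum_i \sum_k G i k - \sum_i \sum_k K i k)).
  move=> e; apply/eqP; rewrite -addr_eq0 !scalerBr addrACA -opprD subr_eq0.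
  rewrite !scaler_sumr -!big_split; apply/eqP/eq_bigr => i _.
  by rewrite /= !scaler_sumr -!big_split; apply: eq_bigr => k _; exact: e.
have e1 : u *: a = - (eta *: b).
  by rewrite aE /b; apply: lin => i k; exact: r.
have e2 : u *: b = - (eta *: a).
  rewrite aE b'.
  have -> : \sum_i \sum_k (X i i * Y k k) = \sum_k \sum_i (X i i * Y k k) by exact: exchange_big.
  by apply: lin => i k; exact: r.
have : (u ^+ 2 - eta ^+ 2) *: a = 0.
  rewrite scalerBl !expr2 -!scalerA e1 scalerN [u *: (_ *: _)]scalerA mulrC.
  by rewrite -scalerA e2 scalerN opprK subrr.
by move=> /eqP; rewrite scaler_eq0 subr_eq0 (negPf ue) subr_eq0 => /eqP.
Qed.


(** * The Levi-Civita symbol, written as half a Vandermonde product, and the quantum determinant *)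

Definition levi (i j k : 'I_3) : C :=
  (j%:R - i%:R) * (k%:R - i%:R) * (k%:R - j%:R) / 2%:R.

Lemma leviCl i j k : levi j i k = - levi i j k.
Proof. by rewrite /levi; ring. Qed.

Lemma leviCr i j k : levi i k j = - levi i j k.
Proof. by rewrite /levi; ring. Qed.

Lemma levi012 : levi 0 1 2 = 1.
Proof.
have -> : levi 0 1 2 = ((1 - 0) * (2 - 0) * (2 - 1)) / 2%:R :> C by [].
by field.
Qed.

Lemma levi_anti (F : 'I_3 -> 'I_3 -> 'I_3 -> A) :
  (forall j l n, F l j n = - F j l n) -> (forall j l n, F j n l = - F j l n) ->
  forall j l n, F j l n = levi j l n *: F 0 1 2.
Proof.
move=> Fl Fr.
have F0 j n : F j j n = 0 by apply: double_eq0; rewrite -Fl.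
have F1 j n : F j n n = 0 by apply: double_eq0; rewrite -Fr.
have F2 j n : F j n j = 0 by rewrite Fl F1 oppr0.
have e0 j n : levi j j n = 0 by rewrite /levi; ring.
have e1 j n : levi j n n = 0 by rewrite /levi; ring.
have e2 j n : levi j n j = 0 by rewrite /levi; ring.
have I3 (P : 'I_3 -> Prop) : P 0 -> P 1 -> P 2 -> forall i, P i.
  move=> p0 p1 p2 [[|[|[|//]]] h].
  - by rewrite (_ : Ordinal h = 0) //; apply: val_inj.
  - by rewrite (_ : Ordinal h = 1) //; apply: val_inj.
  - by rewrite (_ : Ordinal h = 2) //; apply: val_inj.
elim/I3; elim/I3; elim/I3; rewrite ?F0 ?F1 ?F2 ?e0 ?e1 ?e2 ?scale0r //.
- by rewrite levi012 scale1r.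
- by rewrite (Fr 0 1 2) leviCr levi012 scaleN1r.
- by rewrite (Fl 0 1 2) leviCl levi012 scaleN1r.
- by rewrite (Fr 1 0 2) (Fl 0 1 2) leviCr leviCl levi012 !opprK scale1r.
- by rewrite (Fl 0 2 1) (Fr 0 1 2) leviCl leviCr levi012 !opprK scale1r.
- by rewrite (Fl 1 2 0) (Fr 1 0 2) (Fl 0 1 2) leviCl leviCr leviCl levi012 !opprK scaleN1r.
Qed.

(** Only the rows are contracted; the free columns [j l n] allow the quantum determinant to be
    treated as an alternating tensor. *)
Definition qdet3 X Y Z j l n : A :=
  \sum_i \sum_k \sum_m levi i k m *: (X i j * Y k l * Z m n).

Lemma sum_levi_syml (F : 'I_3 -> 'I_3 -> 'I_3 -> A) :
  (forall i k m, F k i m = F i k m) -> \sum_i \sum_k \sum_m levi i k m *: F i k m = 0.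
Proof.
move=> Fs; apply: double_eq0; rewrite [LHS]exchange_big -sumrN.
apply: eq_bigr => i _; rewrite -sumrN; apply: eq_bigr => k _.
by rewrite -sumrN; apply: eq_bigr => m _; rewrite leviCl Fs scaleNr.
Qed.

Lemma sum_levi_symr (F : 'I_3 -> 'I_3 -> 'I_3 -> A) :
  (forall i k m, F i m k = F i k m) -> \sum_i \sum_k \sum_m levi i k m *: F i k m = 0.
Proof.
move=> Fs; rewrite big1 // => i _; apply: double_eq0; rewrite [LHS]exchange_big -sumrN.
apply: eq_bigr => k _; rewrite -sumrN; apply: eq_bigr => m _.
by rewrite leviCr Fs scaleNr.
Qed.

(** Fusion turns the antisymmetry of [levi] in two adjacent rows into antisymmetry in the
    corresponding columns, so the columns alternate. *)
Lemma qdet3_anti X Y Z j l n : fused X Y -> fused Y Z ->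
  qdet3 X Y Z j l n = levi j l n *: qdet3 X Y Z 0 1 2.
Proof.
move=> fXY fYZ; move: j l n.
have add (F G : 'I_3 -> 'I_3 -> 'I_3 -> A) :
    \sum_i \sum_k \sum_m levi i k m *: F i k m + \sum_i \sum_k \sum_m levi i k m *: G i k m
    = \sum_i \sum_k \sum_m levi i k m *: (F i k m + G i k m).
  rewrite -big_split; apply: eq_bigr => i _; rewrite -big_split.
  apply: eq_bigr => k _; rewrite -big_split; apply: eq_bigr => m _.
  by rewrite scalerDr.
apply: levi_anti => j l n; apply/eqP; rewrite -addr_eq0 add; apply/eqP.
  by apply: sum_levi_syml => i k m; rewrite -!mulrDl fXY.
by apply: sum_levi_symr => i k m; rewrite -!mulrA -!mulrDr fYZ.
Qed.

(** Summing first over the outer rows leaves [qdet3 X Y Z p q r], a multiple of [levi p q r]; this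
    symbol then contracts the rows of the primed factors. *)
Lemma qdet3_mul X Y Z X' Y' Z' j l n :
  entries_comm X' Y -> entries_comm X' Z -> entries_comm Y' Z ->
  fused X Y -> fused Y Z ->
  qdet3 (X * X') (Y * Y') (Z * Z') j l n = qdet3 X Y Z 0 1 2 * qdet3 X' Y' Z' j l n.
Proof.
move=> cXY cXZ cYZ fXY fYZ.
pose F p q r := X' p j * Y' q l * Z' r n.
transitivity (\sum_p \sum_q \sum_r qdet3 X Y Z p q r * F p q r).
  have triple i k m : (X * X') i j * (Y * Y') k l * (Z * Z') m n =
      \sum_p \sum_q \sum_r (X i p * Y k q * Z m r) * F p q r.
    rewrite mul_entries2 // mulr_suml; apply: eq_bigr => p _.
    rewrite mulr_suml; apply: eq_bigr => q _; rewrite mxE mulr_sumr.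
    apply: eq_bigr => r _; rewrite /F -!mulrA; congr (_ * (_ * _)).
    by rewrite [Y' q l * (_ * _)]mulrA cYZ -mulrA [LHS]mulrA cXZ -mulrA.
  have ex3 (G : 'I_3 -> 'I_3 -> 'I_3 -> 'I_3 -> 'I_3 -> 'I_3 -> A) :
      \sum_i \sum_k \sum_m \sum_p \sum_q \sum_r G i k m p q r
      = \sum_p \sum_q \sum_r \sum_i \sum_k \sum_m G i k m p q r.
    have ex1 (H : 'I_3 -> 'I_3 -> 'I_3 -> 'I_3 -> A) :
        \sum_m \sum_p \sum_q \sum_r H m p q r = \sum_p \sum_q \sum_r \sum_m H m p q r.
      rewrite exchange_big; apply: eq_bigr => p _; rewrite exchange_big.
      by apply: eq_bigr => q _; exact: exchange_big.
    under eq_bigr => i _ do under eq_bigr => k _ do rewrite ex1.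
    under eq_bigr => i _ do rewrite ex1.
    exact: ex1.
  rewrite /qdet3.
  under eq_bigr => i _ do under eq_bigr => k _ do under eq_bigr => m _
    do rewrite triple scaler_sumr.
  under eq_bigr => i _ do under eq_bigr => k _ do under eq_bigr => m _
    do under eq_bigr => p _ do rewrite scaler_sumr.
  under eq_bigr => i _ do under eq_bigr => k _ do under eq_bigr => m _
    do under eq_bigr => p _ do under eq_bigr => q _ do rewrite scaler_sumr.
  rewrite ex3; apply: eq_bigr => p _; apply: eq_bigr => q _; apply: eq_bigr => r _.
  rewrite mulr_suml; apply: eq_bigr => i _; rewrite mulr_suml; apply: eq_bigr => k _.
  by rewrite mulr_suml; apply: eq_bigr => m _; rewrite scale_mull.
rewrite {2}/qdet3 mulr_sumr; apply: eq_bigr => p _.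
rewrite mulr_sumr; apply: eq_bigr => q _; rewrite mulr_sumr; apply: eq_bigr => r _.
by rewrite qdet3_anti // -scale_mull scale_mulr.
Qed.

(** * Trace over the antisymmetrized auxiliary square: [tr2 X Y] is the trace of $P^-X_1Y_2$ *)

Definition tr2 X Y : A := 2%:R^-1 *: (\tr X * \tr Y - \tr (X * Y)).

Lemma tr_mul_tr X Y : \tr X * \tr Y = \sum_i \sum_k X i i * Y k k.
Proof. by rewrite /mxtrace big_distrlr. Qed.

Lemma tr_mulE X Y : \tr (X * Y) = \sum_i \sum_k X k i * Y i k.
Proof.
by rewrite exchange_big; apply: eq_bigr => i _; rewrite mxE.
Qed.

Lemma tr2_left_sym X Y : left_sym X Y -> tr2 X Y = 0.
Proof.
move=> s; rewrite /tr2 tr_mul_tr tr_mulE [X in _ - X](_ : _ = \sum_i \sum_k X i i * Y k k).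
  by rewrite subrr scaler0.
by apply: eq_bigr => i _; apply: eq_bigr => k _; rewrite s.
Qed.

Lemma tr2_right_anti X Y : right_anti X Y -> tr2 X Y = \tr X * \tr Y.
Proof.
move=> s; rewrite /tr2 tr_mulE.
have -> : \sum_i \sum_k X k i * Y i k = - (\tr X * \tr Y).
  rewrite tr_mul_tr -sumrN exchange_big; apply: eq_bigr => i _.
  by rewrite -sumrN; apply: eq_bigr => k _; rewrite s.
by rewrite opprK -mulr2n -scaler_nat scalerA mulVf ?scale1r // pnatr_eq0.
Qed.

(** Antisymmetrizing the first two rows of $X_1Y_2Z_3$ makes the columns alternate: the first pair
    by fusion, the second by [right_anti]. The trace is then a sum against [levi], and its two terms
    each give one quantum determinant, which cancels the factor one half. *)
Lemma tr2_mul_tr X Y Z : fused X Y -> right_anti Y Z ->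
  tr2 X Y * \tr Z = qdet3 X Y Z 0 1 2.
Proof.
move=> f a.
pose G i k m j l n : A := X i j * Y k l * Z m n - X k j * Y i l * Z m n.
have GE i k m : G i k m i k m = levi i k m *: G i k m 0 1 2.
  apply: levi_anti => j l n; apply/eqP; rewrite -addr_eq0 addrACA -opprD subr_eq0.
    by rewrite -!mulrDl f.
  by rewrite -!mulrA (a k n m l) (a i n m l) !mulrN !addNr.
have lin (F H : 'I_3 -> 'I_3 -> 'I_3 -> A) :
    \sum_i \sum_k \sum_m F i k m - \sum_i \sum_k \sum_m H i k m
    = \sum_i \sum_k \sum_m (F i k m - H i k m).
  rewrite -sumrB; apply: eq_bigr => i _; rewrite -sumrB.
  by apply: eq_bigr => k _; rewrite -sumrB.
have -> : tr2 X Y * \tr Z = 2%:R^-1 *: \sum_i \sum_k \sum_m G i k m i k m.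
  rewrite /tr2 -scale_mull mulrBl tr_mul_tr tr_mulE -lin; congr (_ *: (_ - _)).
    rewrite mulr_suml; apply: eq_bigr => i _; rewrite mulr_suml.
    by apply: eq_bigr => k _; rewrite mulr_sumr.
  rewrite mulr_suml; apply: eq_bigr => i _; rewrite mulr_suml.
  by apply: eq_bigr => k _; rewrite mulr_sumr.
under eq_bigr => i _ do under eq_bigr => k _ do under eq_bigr => m _ do rewrite GE scalerBr.
rewrite -lin [X in _ - X](_ : _ = - qdet3 X Y Z 0 1 2).
  by rewrite opprK -mulr2n -scaler_nat scalerA mulVf ?scale1r // pnatr_eq0.
rewrite exchange_big -sumrN; apply: eq_bigr => i _; rewrite -sumrN; apply: eq_bigr => k _.
by rewrite -sumrN; apply: eq_bigr => m _; rewrite leviCl scaleNr.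
Qed.

End YangBaxter.

(** * Elementary operators and the R-matrix *)

Section ElementaryOperators.
Variables (C : numFieldType) (N : nat).
Implicit Types (n m : 'I_N) (a b : 'I_3) (c : cfgT N).

Definition upd c n a : cfgT N := [ffun m => if m == n then a else c m].

Definition ket c : 'cV[C]_(Hdim N) := delta_mx (enum_rank c) 0.

(** The action on basis vectors, from which the matrix unit relations below are all read off. *)
Lemma Eop_ket n a b c : Eop C n a b *m ket c = (c n == b)%:R *: ket (upd c n a).
Proof.
apply/matrixP => i j; rewrite [j]ord1 {j} !mxE (bigD1 (enum_rank c)) //= big1.
  rewrite !mxE addr0 !eqxx mulr1 /cfg enum_rankK -natrM mulnb andbT; congr ((nat_of_bool _)%:R).
  have -> : (i == enum_rank (upd c n a)) = (cfg i == upd c n a).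
    by rewrite -(inj_eq enum_val_inj) enum_rankK.
  rewrite andbAC andbC; congr andb; apply/andP/eqP => [[/eqP ia /forallP ic]|].
    apply/ffunP => m; rewrite ffunE; case: eqVneq => [->//|mn].
    by apply/eqP; have := ic m; rewrite mn.
  rewrite /cfg => ->; rewrite ffunE eqxx; split=> //; apply/forallP => m.
  by apply/implyP => /negPf mn; rewrite ffunE mn.
by move=> j /negPf jc; rewrite !mxE jc mulr0.
Qed.

Lemma ket_ext (M M' : 'M[C]_(Hdim N)) :
  (forall c, M *m ket c = M' *m ket c) -> M = M'.
Proof.
move=> h; apply/matrixP => i j; have := h (enum_val j).
by rewrite /ket enum_valK -!colE => /matrixP/(_ i 0); rewrite !mxE.
Qed.

Lemma Eop_mul n a b a' b' :
  Eop C n a b * Eop C n a' b' = (b == a')%:R *: Eop C n a b'.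
Proof.
apply: ket_ext => c; rewrite -mulmxA Eop_ket -scalemxAl Eop_ket -scalemxAr Eop_ket.
rewrite !scalerA mulrC ffunE eqxx eq_sym; congr (_ *: ket _).
by apply/ffunP => m; rewrite !ffunE; case: eqP.
Qed.

Lemma Eop_comm n m a b a' b' : n != m ->
  Eop C n a b * Eop C m a' b' = Eop C m a' b' * Eop C n a b.
Proof.
move=> nm; apply: ket_ext => c; rewrite -!mulmxA !Eop_ket -!scalemxAr !Eop_ket.
rewrite !scalerA !ffunE [m == n]eq_sym (negPf nm) mulrC; congr (_ *: ket _).
apply/ffunP => p; rewrite !ffunE; case: eqVneq => [->|//].
by rewrite (negPf nm).
Qed.

Lemma sum_Eop n : \sum_a Eop C n a a = 1.
Proof.
apply: ket_ext => c; rewrite mul1mx mulmx_suml (bigD1 (c n)) //= big1 ?addr0.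
  rewrite Eop_ket eqxx scale1r; congr ket; apply/ffunP => m; rewrite ffunE.
  by case: eqP => // ->.
by move=> a ac; rewrite Eop_ket eq_sym (negPf ac) scale0r.
Qed.
End ElementaryOperators.

(** * A single site: the R-matrix over abstract matrix units [E] *)

Section Site.
Variables (C : numFieldType) (D : nat) (eta : C).
Local Notation A := 'M[C]_D.
Variable E : 'I_3 -> 'I_3 -> A.
Hypothesis E_mul : forall a b c d, E a b * E c d = (b == c)%:R *: E a d.
Hypothesis E_sum : \sum_a E a a = 1.

Definition site (mu : C) : 'M[A]_3 :=
  \matrix_(g, d) ((mu * (g == d)%:R)%:M + eta *: E d g).

Lemma scalar_mull (a : C) (w : A) : a%:M * w = a *: w.
Proof. exact: mul_scalar_mx. Qed.

Lemma scalar_mulr (a : C) (w : A) : w * a%:M = a *: w.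
Proof. exact: mul_mx_scalar. Qed.

Lemma scalar_mul (a b : C) : a%:M * b%:M = (a * b)%:M :> A.
Proof. by rewrite scalar_mull scale_scalar_mx. Qed.

Lemma site_mul2 a b i j k l : site a i j * site b k l =
  (a * b * (i == j)%:R * (k == l)%:R)%:M + (eta * a * (i == j)%:R) *: E l k
  + (eta * b * (k == l)%:R) *: E j i + (eta ^+ 2 * (i == l)%:R) *: E j k.
Proof.
rewrite !mxE mulrDl !mulrDr scalar_mul scalar_mull scalar_mulr.
rewrite -scale_mull -scale_mulr E_mul !scalerA addrA.
by congr (_%:M + _ *: _ + _ *: _ + _ *: _); ring.
Qed.

Lemma site_rtt a b : rtt eta (a - b) (site a) (site b).
Proof.
move=> i j k l; rewrite !site_mul2.
by apply/matrixP => x y; rewrite !mxE; ring.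
Qed.

(** Behind the expansion: $R_{1n}(-\eta)P_{2n}=P_{2n}R_{12}(-\eta)$, and $R_{12}(-\eta)=-2\eta
    P^-$. *)
Lemma site_right_anti : right_anti (site (- eta)) (site 0).
Proof.
move=> i j k l; rewrite !site_mul2.
by apply/matrixP => x y; rewrite !mxE; ring.
Qed.

(** Behind the expansion: $P_{1n}R_{2n}(\eta)=R_{12}(\eta)P_{1n}$, and $R_{12}(\eta)=2\eta P^+$. *)
Lemma site_left_sym : left_sym (site 0) (site eta).
Proof.
move=> i j k l; rewrite !site_mul2.
by apply/matrixP => x y; rewrite !mxE; ring.
Qed.

Lemma site_mul3 a b c i j k l m n : site a i j * site b k l * site c m n =
  (a * b * c * (i == j)%:R * (k == l)%:R * (m == n)%:R)%:M
  + (eta * a * b * (i == j)%:R * (k == l)%:R) *: E n m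
  + (eta * a * c * (i == j)%:R * (m == n)%:R) *: E l k
  + (eta * b * c * (k == l)%:R * (m == n)%:R) *: E j i
  + (eta ^+ 2 * a * (i == j)%:R * (k == n)%:R) *: E l m
  + (eta ^+ 2 * b * (k == l)%:R * (i == n)%:R) *: E j m
  + (eta ^+ 2 * c * (m == n)%:R * (i == l)%:R) *: E j k
  + (eta ^+ 3 * (i == l)%:R * (k == n)%:R) *: E j m.
Proof.
rewrite site_mul2 mxE !mulrDl !mulrDr scalar_mul scalar_mull !scalar_mulr.
rewrite -!scale_mull -!scale_mulr !E_mul !scalerA.
by apply/matrixP => x y; rewrite !mxE; ring.
Qed.

Lemma qdet3E (X Y Z : 'M[A]_3) : qdet3 X Y Z 0 1 2 =
  X 0 0 * Y 1 1 * Z 2 2 - X 1 0 * Y 0 1 * Z 2 2 - X 0 0 * Y 2 1 * Z 1 2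
  + X 1 0 * Y 2 1 * Z 0 2 + X 2 0 * Y 0 1 * Z 1 2 - X 2 0 * Y 1 1 * Z 0 2.
Proof.
have l0 : lift ord0 (ord0 : 'I_2) = 1 :> 'I_3 by apply: val_inj.
have l1 : lift ord0 (lift ord0 (ord0 : 'I_1)) = 2 :> 'I_3 by apply: val_inj.
have e0 (i j : 'I_3) : levi C i i j = 0 by rewrite /levi; ring.
have e1 (i j : 'I_3) : levi C j i i = 0 by rewrite /levi; ring.
have e2 (i j : 'I_3) : levi C i j i = 0 by rewrite /levi; ring.
have z : ord0 = 0 :> 'I_3 by [].
rewrite /qdet3 !(big_ord_recl, big_ord0) !(l0, l1, z) !(e0, e1, e2) !scale0r.
rewrite (leviCl _ 0 1 2) (leviCr _ 0 1 2) (leviCr _ 1 0 2) (leviCl _ 0 1 2).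
rewrite (leviCl _ 1 2 0) (leviCr _ 1 0 2) (leviCl _ 0 2 1) (leviCr _ 0 1 2) (leviCl _ 0 1 2).
rewrite !levi012 !opprK !scaleN1r !scale1r.
by apply/matrixP => x y; rewrite !mxE; ring.
Qed.

Lemma site_qdet3 a :
  qdet3 (site a) (site (a + eta)) (site (a + 2%:R * eta)) 0 1 2
  = (a * (a + eta) * (a + 3%:R * eta))%:M.
Proof.
rewrite qdet3E !site_mul3 /=.
(* The second summand accounts for the diagonal matrix units of the expansion, which add up to the
   identity by [E_sum]. *)
have -> : (a * (a + eta) * (a + 3%:R * eta))%:M =
   (a * (a + eta) * (a + 2%:R * eta))%:M + (a * (a + eta) * eta) *: (1 : A).
  by apply/matrixP => x y; rewrite !mxE; ring.
rewrite -E_sum !big_ord_recl big_ord0.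
have -> : lift ord0 (ord0 : 'I_2) = 1 :> 'I_3 by apply: val_inj.
have -> : lift ord0 (lift ord0 (ord0 : 'I_1)) = 2 :> 'I_3 by apply: val_inj.
have -> : ord0 = 0 :> 'I_3 by [].
by apply/matrixP => x y; rewrite !mxE; ring.
Qed.
End Site.

Lemma det_mx22 (R : comNzRingType) (M : 'M[R]_2) :
  \det M = M 0 0 * M 1 1 - M 0 1 * M 1 0.
Proof.
rewrite (expand_det_row _ 0) !big_ord_recl big_ord0 /cofactor !det_mx11 !mxE /=.
have -> : lift ord0 (ord0 : 'I_1) = 1 :> 'I_2 by apply: val_inj.
have -> : lift 1 (0 : 'I_1) = 0 :> 'I_2 by apply: val_inj.
have -> : ord0 = 0 :> 'I_2 by [].
by rewrite addr0 /bump /= addn0 addn1 expr0 expr1 mul1r mulN1r mulrN.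
Qed.

(** * The twist [K]: scalar entries, so its quantum determinant is the ordinary one *)

Section Twist.
Variables (C : numFieldType) (N : nat) (K : 'M[C]_3).

Lemma Kop_comm (X : 'M['M[C]_(Hdim N)]_3) : entries_comm (Kop N K) X.
Proof. by move=> i j k l; rewrite mxE scalar_mull scalar_mulr. Qed.

Lemma Kop_rtt eta u : rtt eta u (Kop N K) (Kop N K).
Proof.
move=> i j k l; rewrite !mxE !scalar_mul.
by apply/matrixP => x y; rewrite !mxE; ring.
Qed.

Lemma Kop_qdet3 : qdet3 (Kop N K) (Kop N K) (Kop N K) 0 1 2 = (\det K)%:M.
Proof.
rewrite qdet3E !mxE !scalar_mul.
rewrite (expand_det_row _ 0) !big_ord_recl big_ord0 /cofactor !det_mx22.
have -> : lift ord0 (ord0 : 'I_2) = 1 :> 'I_3 by apply: val_inj.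
have -> : lift ord0 (lift ord0 (ord0 : 'I_1)) = 2 :> 'I_3 by apply: val_inj.
rewrite !mxE.
have l00 : lift 0 0 = 1 :> 'I_3 by apply: val_inj.
have l01 : lift 0 1 = 2 :> 'I_3 by apply: val_inj.
have l10 : lift 1 0 = 0 :> 'I_3 by apply: val_inj.
have l11 : lift 1 1 = 2 :> 'I_3 by apply: val_inj.
have l20 : lift 2 0 = 0 :> 'I_3 by apply: val_inj.
have l21 : lift 2 1 = 1 :> 'I_3 by apply: val_inj.
have z : ord0 = 0 :> 'I_3 by [].
rewrite !(l00, l01, l10, l11, l20, l21, z) /=.
by apply/matrixP => x y; rewrite !mxE; ring.
Qed.
End Twist.

(** * Monodromy and transfer matrix *)

Section PolynomialMatrices.
Variables (C : numFieldType) (D : nat).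
Local Notation A := 'M[C]_D.

(** As for [polyfun], [c] holds the coefficients of degree [d]. *)
Definition polymx d (c : 'M[A]_3) (F : C -> 'M[A]_3) :=
  forall i j, polyfun d (c i j) (fun l => F l i j).

Lemma polymx_mul d e c c' F G : polymx d c F -> polymx e c' G ->
  polymx (d + e) (c * c') (fun l => F l * G l).
Proof.
move=> Fd Gd i j; rewrite mxE.
have := @polyfun_sum _ _ (d + e) _ (index_enum 'I_3) xpredT _ _
  (fun k _ => polyfun_mulmx (Fd i k) (Gd k j)).
by apply: polyfun_eq => l; rewrite mxE.
Qed.

Lemma polymx_tr d c F : polymx d c F -> polyfun d (\tr c) (fun l => \tr (F l)).
Proof.
move=> Fd.
exact: (@polyfun_sum _ _ d _ (index_enum 'I_3) xpredT _ _ (fun k _ => Fd k k)).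
Qed.

Lemma polymx_site eta (E : 'I_3 -> 'I_3 -> A) z :
  polymx 1 1 (fun l => site eta E (l - z)).
Proof.
move=> i j; exists (fun=> (1 : 'M[A]_3) i j), ((- z * (i == j)%:R)%:M + eta *: E j i).
split=> // l; rewrite !mxE addrA; congr (_ + _).
have -> : (1 *+ (i == j) : A) = ((i == j)%:R)%:M by case: (i == j); rewrite ?raddf0.
by apply/matrixP => x y; rewrite !mxE; ring.
Qed.
End PolynomialMatrices.

Section Monodromy.
Variables (C : numFieldType) (N : nat) (eta : C) (K : 'M[C]_3) (xi : 'I_N -> C).
Local Notation A := 'M[C]_(Hdim N).
Local Notation L n l := (site eta (Eop C n) (l - xi n)).
Implicit Types (s : seq 'I_N) (n m : 'I_N) (l : C).

Definition mono s l : 'M[A]_3 := \prod_(n <- s) L n l.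

Lemma mono_cons n s l : mono (n :: s) l = L n l * mono s l.
Proof. exact: big_cons. Qed.

Lemma mono_cat s s' l : mono (s ++ s') l = mono s l * mono s' l.
Proof. exact: big_cat. Qed.

Lemma site_comm n m a b : n != m ->
  entries_comm (site eta (Eop C n) a) (site eta (Eop C m) b).
Proof.
move=> nm i j k l; rewrite !mxE !mulrDl !mulrDr !scalar_mull !scalar_mulr.
rewrite -!scale_mull -!scale_mulr (Eop_comm _ _ _ _ _ nm) !scale_scalar_mx.
by apply/matrixP => x y; rewrite !mxE; ring.
Qed.

Lemma mono_site_comm s n l b : n \notin s -> entries_comm (mono s l) (site eta (Eop C n) b).
Proof.
elim: s => [|m s IH]; first by move=> _; rewrite /mono big_nil; apply: entries_comm1.
rewrite inE negb_or mono_cons => /andP[nm ns].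
by apply: entries_comm_mull; [apply: site_comm; rewrite eq_sym | apply: IH].
Qed.

Lemma mono_comm s s' l l' : ~~ has [in s] s' -> entries_comm (mono s l) (mono s' l').
Proof.
elim: s' => [|m s' IH].
  by move=> _; apply: entries_comm_sym; rewrite {1}/mono big_nil; apply: entries_comm1.
rewrite /= negb_or mono_cons => /andP[ms ss']; apply: entries_comm_sym.
by apply: entries_comm_mull; apply: entries_comm_sym; [apply: mono_site_comm | apply: IH].
Qed.

Lemma mono_rtt s l l' : uniq s -> rtt eta (l - l') (mono s l) (mono s l').
Proof.
elim: s => [|n s IH] /=.
  move=> _ i j k p; rewrite /mono !big_nil !mxE; apply/matrixP => x y.
  by do 4!case: eqP; rewrite !(mulr0, mul0r, mulr1).
move=> /andP[ns us]; rewrite !mono_cons; apply: rtt_mul.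
- exact: mono_site_comm.
- by apply: entries_comm_sym; apply: mono_site_comm.
- rewrite (_ : l - l' = (l - xi n) - (l' - xi n)); last by ring.
  apply: site_rtt; exact: Eop_mul.
- exact: IH.
Qed.

Hypothesis eta0 : eta != 0.

Lemma mono_fused s l l' : uniq s -> l' = l + eta -> fused (mono s l) (mono s l').
Proof.
move=> us ->; apply: (rtt_fused eta0); rewrite (_ : - eta = l - (l + eta)); last by ring.
exact: mono_rtt.
Qed.

Lemma Kop_fused : fused (Kop N K) (Kop N K).
Proof. by apply: (rtt_fused eta0); apply: Kop_rtt. Qed.

Lemma mono_qdet3 s l : uniq s ->
  qdet3 (mono s l) (mono s (l + eta)) (mono s (l + 2%:R * eta)) 0 1 2
  = (\prod_(b <- s) ((l - xi b) * (l + eta - xi b) * (l + 3%:R * eta - xi b)))%:M.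
Proof.
elim: s => [|n s IH] /=.
  move=> _; rewrite /mono !big_nil qdet3E !mxE /=.
  by apply/matrixP => x y; rewrite !(mulr0, mul0r, mulr1, subr0, addr0).
move=> /andP[ns us]; rewrite !mono_cons qdet3_mul.
- rewrite IH // big_cons -scalar_mul; congr (_ * _).
  rewrite (_ : l + eta - xi n = (l - xi n) + eta); last by ring.
  rewrite (_ : l + 2 * eta - xi n = (l - xi n) + 2 * eta); last by ring.
  rewrite (_ : l + 3 * eta - xi n = (l - xi n) + 3 * eta); last by ring.
  by apply: site_qdet3; [exact: Eop_mul | exact: sum_Eop].
- exact: mono_site_comm.
- exact: mono_site_comm.
- exact: mono_site_comm.
- apply: (rtt_fused eta0); rewrite (_ : - eta = (l - xi n) - (l + eta - xi n)); last by ring.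
  by apply: site_rtt; exact: Eop_mul.
- apply: (rtt_fused eta0).
  rewrite (_ : - eta = (l + eta - xi n) - (l + 2 * eta - xi n)); last by ring.
  by apply: site_rtt; exact: Eop_mul.
Qed.

Lemma polymx_mono s : polymx (size s) 1 (mono s).
Proof.
elim: s => [|n s IH].
  by move=> i j l; rewrite /mono big_nil.
have := polymx_mul (polymx_site eta (Eop C n) (xi n)) IH; rewrite mulr1 => h i j.
by apply: polyfun_eq (h i j) => l; rewrite mono_cons.
Qed.

(** Decreasing order, as in the product defining [T1]; a list lets one site be isolated by
    splitting. *)
Definition sites : seq 'I_N := [seq rev_ord n | n <- enum 'I_N].

Lemma sites_uniq : uniq sites.
Proof. by rewrite map_inj_uniq ?enum_uniq //; apply: rev_ord_inj. Qed.

Lemma mem_sites n : n \in sites.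
Proof. by apply/mapP; exists (rev_ord n); rewrite ?mem_enum ?rev_ordK. Qed.

Lemma size_sites : size sites = N.
Proof. by rewrite size_map size_enum_ord. Qed.

Lemma prod_sites (F : 'I_N -> C) : \prod_(n <- sites) F n = \prod_(n < N) F n.
Proof.
rewrite -[RHS]big_enum /=; apply: perm_big; apply: uniq_perm; rewrite ?sites_uniq ?enum_uniq //.
by move=> n; rewrite mem_sites mem_enum.
Qed.

Definition monodromy l : 'M[A]_3 := Kop N K * mono sites l.

Local Notation T l := (T1 eta K xi l).

Lemma T1E l : T l = \tr (monodromy l).
Proof.
by rewrite /T1 /monodromy /mono big_map enumT [index_enum _]unlock.
Qed.

Lemma monodromy_rtt l l' : rtt eta (l - l') (monodromy l) (monodromy l').
Proof.
apply: rtt_mul; first by apply: entries_comm_sym; apply: Kop_comm.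
- exact: Kop_comm.
- exact: Kop_rtt.
- by apply: mono_rtt; apply: sites_uniq.
Qed.

Lemma monodromy_fused l l' : l' = l + eta -> fused (monodromy l) (monodromy l').
Proof.
move=> ->; apply: (rtt_fused eta0); rewrite (_ : - eta = l - (l + eta)); last by ring.
exact: monodromy_rtt.
Qed.

Lemma monodromy_qdet3 l :
  qdet3 (monodromy l) (monodromy (l + eta)) (monodromy (l + 2%:R * eta)) 0 1 2
  = (qdet eta K xi l)%:M.
Proof.
rewrite qdet3_mul; try exact: Kop_fused; try by apply: entries_comm_sym; apply: Kop_comm.
by rewrite Kop_qdet3 mono_qdet3 ?sites_uniq // scalar_mul /qdet prod_sites.
Qed.

Lemma monodromy_split a : exists s1 s2, uniq (s1 ++ a :: s2) /\
  forall l, monodromy l = Kop N K * mono s1 l * L a l * mono s2 l.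
Proof.
rewrite /monodromy; have := sites_uniq.
case/splitPr: sites / (mem_sites a) => s1 s2 us; exists s1, s2; split=> // l.
by rewrite mono_cat mono_cons !mulrA.
Qed.


Hypothesis xi_gap : forall a b : 'I_N, a != b ->
  forall r : int, (-2 <= r <= 2)%R -> xi a != xi b + r%:~R * eta.

Lemma xi_inj : injective xi.
Proof.
move=> a b ab; apply/eqP; apply: contraT => /xi_gap/(_ 0 isT).
by rewrite mul0r addr0 ab eqxx.
Qed.

Lemma xi_gapN a b : a != b ->
  [/\ xi a - xi b != eta, xi a - xi b != - eta & xi a - xi b != 2%:R * eta].
Proof.
move=> ab; have g := xi_gap ab; split.
- by have := g 1 isT; rewrite mul1r subr_eq addrC.
- by have := g (-1) isT; rewrite mulN1r subr_eq addrC.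
- by have := g 2 isT; rewrite subr_eq addrC.
Qed.

(** Differences of distinct nodes avoid $\pm\eta$, the values excluded by [rtt_tr_comm].
    Interpolation later extends commutation to all arguments, these included. *)
Lemma T1_node_comm a b : T (xi a) * T (xi b) = T (xi b) * T (xi a).
Proof.
have [->//|ab] := eqVneq a b; rewrite !T1E.
apply: (rtt_tr_comm _ (monodromy_rtt _ _)).
have [g1 g2 _] := xi_gapN ab.
by rewrite eqf_sqr negb_or g1.
Qed.

Lemma T1_polyfun : polyfun N (\tr K)%:M (fun l => T l).
Proof.
have KP : polymx 0 (Kop N K) (fun=> Kop N K) by move=> i j l.
have := polymx_tr (polymx_mul KP (polymx_mono sites)).
rewrite add0n size_sites mulr1 (_ : \tr (Kop N K) = (\tr K)%:M).
  by apply: polyfun_eq => l; rewrite T1E.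
by rewrite /mxtrace raddf_sum; apply: eq_bigr => i _; rewrite mxE.
Qed.

Lemma T1_interpolate l : T l = (\prod_(n < N) (l - xi n)) *: (\tr K)%:M
  + \sum_(n < N) gfun xi n l *: T (xi n).
Proof. exact: (polyfun_interpolate xi_inj T1_polyfun). Qed.

Lemma T1_comm l l' : T l * T l' = T l' * T l.
Proof.
have c a k : T k * T (xi a) = T (xi a) * T k.
  rewrite T1_interpolate mulrDl mulrDr scale_scalar_mx scalar_mull scalar_mulr.
  congr (_ + _); rewrite [LHS]mulr_suml [RHS]mulr_sumr; apply: eq_bigr => n _.
  by rewrite -scale_mull -scale_mulr T1_node_comm.
rewrite [T l']T1_interpolate mulrDl mulrDr scale_scalar_mx scalar_mull scalar_mulr.
congr (_ + _); rewrite [LHS]mulr_sumr [RHS]mulr_suml; apply: eq_bigr => n _.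
by rewrite -scale_mull -scale_mulr c.
Qed.

(** * The fused transfer matrix and its values at shifted nodes *)

Definition T2 l := tr2 (monodromy l) (monodromy (l + eta)).

Lemma T2_polyfun :
  polyfun (N + N) (((\tr K) ^+ 2 - \tr (K *m K)) / 2%:R)%:M T2.
Proof.
have KP : polymx 0 (Kop N K) (fun=> Kop N K) by move=> i j l.
have MP : polymx N (Kop N K) monodromy.
  have := polymx_mul KP (polymx_mono sites).
  by rewrite add0n size_sites mulr1.
have MP' : polymx N (Kop N K) (fun l => monodromy (l + eta)).
  by move=> i j; exact: (polyfun_shift eta (MP i j)).
have P1 := polyfun_mulmx (polymx_tr MP) (polymx_tr MP').
have P2 := polymx_tr (polymx_mul MP MP').
have := polyfunZ (2%:R^-1) (polyfunD P1 (polyfunZ (-1) P2)).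
have -> : 2^-1 *: (\tr (Kop N K) * \tr (Kop N K) + -1 *: \tr (Kop N K * Kop N K))
    = (((\tr K) ^+ 2 - \tr (K *m K)) / 2%:R)%:M.
  have -> : \tr (Kop N K) = (\tr K)%:M.
    by rewrite /mxtrace raddf_sum; apply: eq_bigr => i _; rewrite mxE.
  have -> : \tr (Kop N K * Kop N K) = (\tr (K *m K))%:M.
    rewrite /mxtrace raddf_sum; apply: eq_bigr => i _; rewrite !mxE raddf_sum.
    by apply: eq_bigr => j _; rewrite !mxE scalar_mul.
  by rewrite scalar_mul; apply/matrixP => x y; rewrite !mxE; ring.
by apply: polyfun_eq => l; rewrite scaleN1r.
Qed.

(** At site [a] the factors are $R(0)$ and $R(\eta)$, whose product is killed by $P^-$ on the left.
    This survives fused factors on the left and arbitrary ones on the right. *)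
Lemma T2_node a : T2 (xi a) = 0.
Proof.
have [s1 [s2 [us E]]] := monodromy_split a.
move: us; rewrite cat_uniq /= negb_or => /and4P[us1 /andP[as1 s12] as2 us2].
apply: tr2_left_sym; rewrite !E; apply: left_sym_mulr.
  apply: entries_comm_sym; apply: entries_comm_mull.
    by apply: entries_comm_mull; [exact: Kop_comm | exact: mono_comm].
  by apply: entries_comm_sym; apply: mono_site_comm.
apply: left_sym_mull.
- apply: entries_comm_sym.
  by apply: entries_comm_mull; [exact: Kop_comm | exact: mono_site_comm].
- apply: fused_mul; [| exact: Kop_fused | exact: mono_fused].
  exact: entries_comm_sym (Kop_comm _ _).
- rewrite subrr addrC addKr; apply: site_left_sym; exact: Eop_mul.
Qed.

(** At site [a] the factors are $R(-\eta)$ and $R(0)$, killed by $P^+$ on the right. This survives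
    arbitrary factors on the left and fused ones on the right. *)
Lemma monodromy_right_anti a : right_anti (monodromy (xi a - eta)) (monodromy (xi a)).
Proof.
have [s1 [s2 [us E]]] := monodromy_split a.
move: us; rewrite cat_uniq /= negb_or => /and4P[us1 /andP[as1 s12] as2 us2].
rewrite !E => i j k l; move: i j k l; apply: right_anti_mulr.
- apply: entries_comm_sym; apply: entries_comm_mull.
    by apply: entries_comm_mull; [exact: Kop_comm | exact: mono_comm].
  by apply: entries_comm_sym; apply: mono_site_comm.
- apply: right_anti_mull.
    apply: entries_comm_sym.
    by apply: entries_comm_mull; [exact: Kop_comm | exact: mono_site_comm].
  rewrite subrr addrAC subrr sub0r; apply: site_right_anti; exact: Eop_mul.
- by apply: mono_fused; rewrite ?subrK.
Qed.

Lemma T2_shift a : T2 (xi a - eta) = T (xi a - eta) * T (xi a).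
Proof. by rewrite /T2 subrK tr2_right_anti ?T1E //; apply: monodromy_right_anti. Qed.

Lemma prod_shift_neq0 n : \prod_(b < N) (xi n - eta - xi b) != 0.
Proof.
apply/prodf_neq0 => b _; rewrite subr_eq0 subr_eq addrC -subr_eq eq_sym.
have [->|nb] := eqVneq n b; first by rewrite subrr.
by have [] := xi_gapN nb; rewrite eq_sym.
Qed.

(** Identifies [ffun_] as the Lagrange weight at the nodes $\xi_b-\eta$ times a product vanishing at
    every $\xi_b$, normalized at $\xi_n-\eta$. *)
Lemma ffun__gfunE n l : ffun_ eta xi n l =
  \prod_(b < N) (l - xi b) * gfun (fun b => xi b - eta) n l
  / \prod_(b < N) (xi n - eta - xi b).
Proof.
rewrite /ffun_ [X in _ * X = _]prodf_div mulrA [X in X / _]mulrC; congr (_ * _ / _).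
by apply: eq_bigr => b _; congr (_ / _); ring.
Qed.

(** The [N] zeros of [T2_node] leave a quotient of degree at most [N], which is interpolated at the
    nodes $\xi_n-\eta$ with the values from [T2_shift]. *)
Lemma T2E l : T2 l = (T2inf eta K xi l)%:M
  + \sum_(n < N) ffun_ eta xi n l *: (T (xi n - eta) * T (xi n)).
Proof.
have sz : (size [seq xi n | n <- sites] + N = N + N)%N by rewrite size_map size_sites.
have := T2_polyfun; rewrite -sz => P.
have [||h hd hE] := polyfun_zeros _ _ P.
- by rewrite map_inj_uniq ?sites_uniq //; apply: xi_inj.
- by move=> _ /mapP[n _ ->]; apply: T2_node.
have prodE k : \prod_(z <- [seq xi n | n <- sites]) (k - z) = \prod_(n < N) (k - xi n).
  by rewrite big_map prod_sites.
have shift_inj : injective (fun n => xi n - eta) by move=> a b /addIr/xi_inj.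
rewrite hE (polyfun_interpolate shift_inj hd) scalerDr prodE; congr (_ + _).
  rewrite !scale_scalar_mx /T2inf mulrA -big_split mulrC /=; congr ((_ * _)%:M).
  by apply: eq_bigr => n _; ring.
rewrite scaler_sumr; apply: eq_bigr => n _; rewrite -T2_shift hE prodE !scalerA.
by rewrite ffun__gfunE divfK ?prod_shift_neq0.
Qed.

(** This is $T_1(\xi_a)T_2(\xi_a-2\eta)=q(\xi_a-2\eta)$ with [T2] interpolated: three fused
    monodromies, the last two right antisymmetric, give the quantum determinant by [tr2_mul_tr]. *)
Lemma T1_cubic a :
  T (xi a) * ((T2inf eta K xi (xi a - 2%:R * eta))%:M
     + \sum_(n < N) ffun_ eta xi n (xi a - 2%:R * eta) *: (T (xi n - eta) * T (xi n)))
  = (qdet eta K xi (xi a - 2%:R * eta))%:M.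
Proof.
have comm : T (xi a) * T2 (xi a - 2%:R * eta) = T2 (xi a - 2%:R * eta) * T (xi a).
  rewrite T2E [LHS]mulrDr [RHS]mulrDl [X in X + _ = _]scalar_mulr [X in _ = X + _]scalar_mull.
  congr (_ + _).
  rewrite [LHS]mulr_sumr [RHS]mulr_suml; apply: eq_bigr => n _.
  rewrite -scale_mulr -scale_mull mulrA (T1_comm (xi a) (xi n - eta)).
  by rewrite -mulrA (T1_comm (xi a)) mulrA.
rewrite -T2E comm -monodromy_qdet3 T1E subrK /T2.
rewrite (_ : xi a - 2 * eta + eta = xi a - eta); last by ring.
apply: tr2_mul_tr; last exact: monodromy_right_anti.
by apply: monodromy_fused; ring.
Qed.

End Monodromy.

(** * Spanning by monomials of exponents at most two *)

Section Spanning.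
Variables (C : numFieldType) (N D : nat).
Local Notation A := 'M[C]_D.
Variable tau : 'I_N -> A.
Hypothesis tau_comm : forall n m, tau n * tau m = tau m * tau n.
Implicit Types (a b x : A) (d e : nat) (n m : 'I_N) (G : nat -> A -> Prop).

(* [filt d] consists of the polynomials in the [tau n] of degree strictly less
   than [d]; this shift makes truncated subtraction of degrees harmless. *)
Inductive filt : nat -> A -> Prop :=
| filt0 d : filt d 0
| filt_scalar d (c : C) : filt d.+1 c%:M
| filtD d a b : filt d a -> filt d b -> filt d (a + b)
| filt_tau d n b : filt d b -> filt d.+1 (tau n * b).

Lemma filt_lt0 b : filt 0 b -> b = 0.
Proof.
move=> h; have : forall d, filt d b -> d = 0%N -> b = 0; last by move=> /(_ 0%N h erefl).
move=> d {h}; elim=> // {}d a b' _ IHa _ IHb /[dup] /IHa-> /IHb->.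
by rewrite addr0.
Qed.

Lemma filtZ d (c : C) b : filt d b -> filt d (c *: b).
Proof.
elim=> {d b} [d|d c'|d a b _ ha _ hb|d n b _ hb].
- by rewrite scaler0; exact: filt0.
- by rewrite scale_scalar_mx; exact: filt_scalar.
- by rewrite scalerDr; exact: filtD.
- by rewrite scale_mulr; exact: filt_tau.
Qed.

Lemma filt_leq d e b : (d <= e)%N -> filt d b -> filt e b.
Proof.
move=> de h; elim: h e de => {d b} [d|d c|d a b _ ha _ hb|d n b _ hb] e.
- by move=> _; exact: filt0.
- by case: e => // e _; exact: filt_scalar.
- by move=> de; apply: filtD; [exact: ha | exact: hb].
- by case: e => // e de; apply: filt_tau; apply: hb.
Qed.

Lemma filt_sum d (I : Type) (s : seq I) (f : I -> A) :
  (forall i, filt d (f i)) -> filt d (\sum_(i <- s) f i).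
Proof.
move=> fd; elim: s => [|i s IH]; first by rewrite big_nil; exact: filt0.
by rewrite big_cons; exact: filtD.
Qed.

Lemma filtM d e a b : filt d.+1 a -> filt e b -> filt (d + e) (a * b).
Proof.
move=> ha hb; have : forall d, filt d a -> filt (d.-1 + e) (a * b); last by move/(_ _ ha).
move=> {d ha} d; elim=> {d a} [d|d c|d a a' _ ha _ ha'|d n a h ha].
- by rewrite mul0r; exact: filt0.
- by rewrite scalar_mull; apply: filtZ; apply: filt_leq hb; apply: leq_addl.
- by rewrite mulrDl; exact: filtD.
- case: d h ha => [|d] h ha; last by rewrite -mulrA; exact: filt_tau.
  by rewrite (filt_lt0 h) mulr0 mul0r; exact: filt0.
Qed.

Lemma filtC d e a b : filt d a -> filt e b -> a * b = b * a.
Proof.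
move=> ha hb; elim: ha => {d a} [d|d c|d a a' _ IH _ IH'|d n a _ IH].
- by rewrite mul0r mulr0.
- by rewrite scalar_mull scalar_mulr.
- by rewrite mulrDl mulrDr IH IH'.
rewrite -mulrA IH !mulrA; congr (_ * _).
elim: hb => {e b IH} [e|e c|e b b' _ IH _ IH'|e m b _ IH].
- by rewrite mul0r mulr0.
- by rewrite scalar_mull scalar_mulr.
- by rewrite mulrDl mulrDr IH IH'.
by rewrite mulrA tau_comm -mulrA IH mulrA.
Qed.

Lemma filt_gen n : filt 2 (tau n).
Proof. by rewrite -[tau n]mulr1; apply: filt_tau; exact: filt_scalar. Qed.

(* Lower degrees are included: this is an ideal of the associated graded ring. *)
Inductive gideal G : nat -> A -> Prop :=
| gideal_low d b : filt d.-1 b -> gideal G d b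
| gideal_gen d e l b : G e l -> filt (d - e) b -> gideal G d (l * b)
| gidealD d a b : gideal G d a -> gideal G d b -> gideal G d (a + b).

Lemma gideal0 G d : gideal G d 0.
Proof. by apply: gideal_low; exact: filt0. Qed.

Lemma gideal_lt0 G b : gideal G 0 b -> b = 0.
Proof.
move=> h; have : forall d, gideal G d b -> d = 0%N -> b = 0; last by move=> /(_ 0%N h erefl).
move=> d {h}; elim=> {d b} [d b h d0|d e l b _ h d0|d a b _ IHa _ IHb d0].
- by move: h; rewrite d0 => /filt_lt0.
- by move: h; rewrite d0 sub0n => /filt_lt0->; rewrite mulr0.
- by rewrite IHa // IHb // addr0.
Qed.

Lemma gideal_sum G d (I : Type) (s : seq I) (f : I -> A) :
  (forall i, gideal G d (f i)) -> gideal G d (\sum_(i <- s) f i).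
Proof.
move=> fd; elim: s => [|i s IH]; first by rewrite big_nil; exact: gideal0.
by rewrite big_cons; exact: gidealD.
Qed.

Definition homog G := forall e l, G e l -> filt e.+1 l.

Lemma gidealM G d e a b : homog G -> filt e.+1 a -> gideal G d b -> gideal G (d + e) (a * b).
Proof.
move=> hG ha; elim=> {d b} [d b h|d e' l b Gl h|d b b' _ IH _ IH'].
- case: d h => [|d] h; first by rewrite (filt_lt0 h) mulr0; exact: gideal0.
  by apply: gideal_low; rewrite addSn /= addnC; apply: filtM.
- rewrite mulrA (filtC ha (hG _ _ Gl)) -mulrA.
  have [de|/ltnW] := leqP e' d.
    by apply: gideal_gen Gl _; rewrite -addnBAC // addnC; apply: filtM.
  rewrite -subn_eq0 => /eqP de; move: h; rewrite de => /filt_lt0->.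
  by rewrite !mulr0; exact: gideal0.
- by rewrite mulrDr; exact: gidealD.
Qed.

Lemma gidealM_sub G d e a b : homog G -> filt e.+1 a -> gideal G (d - e) b -> gideal G d (a * b).
Proof.
move=> hG ha; have [de|/ltnW] := leqP e d.
  by move=> /(gidealM hG ha); rewrite subnK.
rewrite -subn_eq0 => /eqP-> /gideal_lt0->.
by rewrite mulr0; exact: gideal0.
Qed.

Lemma gideal_trans G G' d b :
  (forall d e l b, G e l -> filt (d - e) b -> gideal G' d (l * b)) ->
  gideal G d b -> gideal G' d b.
Proof.
move=> sub; elim=> {d b} [d b h|d e l b Gl h|d a b _ ha _ hb].
- exact: gideal_low.
- exact: sub Gl h.
- exact: gidealD.
Qed.

Definition add_gen G e0 l0 e (l : A) := G e l \/ (e = e0 /\ l = l0).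

(** All multiples of the new generator are collected into one cofactor [c] of controlled degree. *)
Lemma gideal_add_gen G e0 l0 d b : gideal (add_gen G e0 l0) d b ->
  exists j c, [/\ gideal G d j, filt (d - e0) c & b = j + l0 * c].
Proof.
elim=> {d b} [d b h|d e l b [Gl|[-> ->]] h|d a b _ [j [c [hj hc ->]]] _ [j' [c' [hj' hc' ->]]]].
- exists b, 0; split; [exact: gideal_low | exact: filt0 | by rewrite mulr0 addr0].
- exists (l * b), 0; split; [exact: gideal_gen Gl h | exact: filt0 | by rewrite mulr0 addr0].
- by exists 0, b; split; [exact: gideal0 | | rewrite add0r].
- exists (j + j'), (c + c'); split; [exact: gidealD | exact: filtD | ].
  by rewrite mulrDr addrACA.
Qed.

(** A spanning statement in the associated graded quotient; the representative [x] itself carries no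
    degree bound. *)
Definition covers (X : A -> Prop) G :=
  forall d b, filt d b -> exists x, X x /\ gideal G d (b - x).

Lemma covers_trans X G G' :
  (forall d e l b, G e l -> filt (d - e) b -> gideal G' d (l * b)) ->
  covers X G -> covers X G'.
Proof.
move=> sub cov d b /cov[x [Xx h]]; exists x; split=> //.
exact: gideal_trans sub h.
Qed.

(* If [M := filt/G] is spanned by [X] modulo [l M], by [X'] modulo [r M], and
   if [l r M = 0], then [M] is spanned by [X + l X']. *)
Lemma covers_mul X X' X'' G e l e' r :
  homog G -> filt e.+1 l ->
  (forall d b, filt (d - e - e') b -> gideal G d (l * (r * b))) ->
  (forall x x', X x -> X' x' -> X'' (x + l * x')) ->
  covers X (add_gen G e l) -> covers X' (add_gen G e' r) -> covers X'' G.
Proof.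
move=> hG hl lm XX cov cov' d b /cov[x [Xx /gideal_add_gen[j [c [hj hc bE]]]]].
have [x' [Xx' /gideal_add_gen[j' [c' [hj' hc' cE]]]]] := cov' _ _ hc.
exists (x + l * x'); split; first exact: XX.
have -> : b - (x + l * x') = j + (l * j' + l * (r * c')).
  by rewrite -mulrDr -cE mulrBr opprD !addrA -bE addrC.
by apply: gidealD => //; apply: gidealD; [exact: gidealM_sub hj' | exact: lm].
Qed.

Definition monomial (h : 'I_N -> nat) : A := \prod_(n < N) tau n ^+ h n.

Inductive mono_span (cap : 'I_N -> nat) : A -> Prop :=
| mono_span0 : mono_span cap 0
| mono_spanZ (c : C) h : (forall n, (h n <= cap n)%N) -> mono_span cap (c *: monomial h)
| mono_spanD a b : mono_span cap a -> mono_span cap b -> mono_span cap (a + b).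

Lemma tau_monomial m h :
  tau m * monomial h = monomial (fun n => (h n + (n == m))%N).
Proof.
have comm n k : tau m * tau n ^+ k = tau n ^+ k * tau m.
  by apply: commrX; exact: tau_comm.
have comms s : tau m * \prod_(n <- s) tau n ^+ h n = \prod_(n <- s) tau n ^+ h n * tau m.
  by apply: commr_prod => n _; exact: comm.
have gen s : uniq s -> \prod_(n <- s) tau n ^+ (h n + (n == m)) =
    tau m ^+ (m \in s) * \prod_(n <- s) tau n ^+ h n.
  elim: s => [|n s IH]; first by rewrite !big_nil mul1r.
  rewrite /= !big_cons inE => /andP[ns us]; rewrite IH // mulrA.
  rewrite eq_sym; case: (eqVneq m n) ns => [<-|nm] ns /=.
    by rewrite (negPf ns) mulr1 addn1 exprS mulrA.
  rewrite addn0 mulrA; congr (_ * _).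
  by case: (m \in s); rewrite ?expr0 ?mulr1 ?mul1r ?expr1 ?comm.
by rewrite /monomial gen ?index_enum_uniq // mem_index_enum expr1.
Qed.

Lemma mono_span_leq cap cap' b : (forall n, (cap n <= cap' n)%N) ->
  mono_span cap b -> mono_span cap' b.
Proof.
move=> le; elim=> {b} [|c h hc|a b _ ha _ hb].
- exact: mono_span0.
- by apply: mono_spanZ => n; apply: leq_trans (le n).
- exact: mono_spanD.
Qed.

Lemma mono_span_tau cap cap' m b : (forall n, (cap n + (n == m) <= cap' n)%N) ->
  mono_span cap b -> mono_span cap' (tau m * b).
Proof.
move=> le; elim=> {b} [|c h hc|a b _ ha _ hb].
- by rewrite mulr0; exact: mono_span0.
- rewrite -scale_mulr tau_monomial; apply: mono_spanZ => n.
  by apply: leq_trans (le n); rewrite leq_add2r.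
- by rewrite mulrDr; exact: mono_spanD.
Qed.

(** * Two-stage elimination of the leading relations *)

Variables y v : 'I_N -> A.
Hypothesis y_deg : forall n, filt 2 (y n).
Hypothesis v_deg : forall n, filt 3 (v n).
Hypothesis tau_v : forall n, filt 3 (tau n * v n).
Hypothesis tau_span : forall (P : pred 'I_N) m, exists k : 'I_N -> C,
  tau m = \sum_n k n *: (if P n then y n else tau n).
Hypothesis ytau_span : forall (P : pred 'I_N) m, exists k : 'I_N -> C,
  y m * tau m = \sum_n k n *: (if P n then v n else y n * tau n).

(* A partial choice [c] kills [tau n] where [c n = Some false]; where
   [c n = Some true] it kills [v n] in the first stage, [y n] in the second. *)
Definition gens1 (c : 'I_N -> option bool) e l :=
  (exists n, [/\ c n = Some false, e = 1%N & l = tau n]) \/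
  (exists n, [/\ c n = Some true, e = 2%N & l = v n]).

Definition gens2 (c : 'I_N -> option bool) e l :=
  (exists n, [/\ c n = Some false, e = 1%N & l = tau n]) \/
  (exists n, [/\ c n = Some true, e = 1%N & l = y n]) \/
  (exists n, e = 2%N /\ l = y n * tau n).

Lemma homog_gens1 c : homog (gens1 c).
Proof. by move=> e l [] [n [_ -> ->]]; [exact: filt_gen | exact: v_deg]. Qed.

Lemma homog_gens2 c : homog (gens2 c).
Proof.
move=> e l [[n [_ -> ->]]|[[n [_ -> ->]]|[n [-> ->]]]]; [exact: filt_gen|exact: y_deg|].
exact: (filtM (y_deg n) (filt_gen n)).
Qed.

Definition set_choice (c : 'I_N -> option bool) n o := fun k => if k == n then o else c k.

(** An index where [v n] is killed keeps exponent 1, since the second stage still has to choose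
    between [tau n] and [y n] there. *)
Definition cap1 (c : 'I_N -> option bool) n : nat :=
  match c n with None => 2 | Some true => 1 | Some false => 0 end.

Definition cap2 (c : 'I_N -> option bool) n : nat := if c n is None then 1%N else 0%N.

(** Once every index is decided, [tau_span] puts each [tau m] in the ideal and only scalars remain.
    An undecided [m] is split by [covers_mul] using the generator [y m * tau m]: one branch
    contributes a factor 1, the other [tau m]. *)
Lemma covers2 (s : seq 'I_N) c : uniq s -> (forall n, (c n == None) = (n \in s)) ->
  covers (mono_span (cap2 c)) (gens2 c).
Proof.
elim: s c => [|m s IH] c /=.
  move=> _ cs d b h; suff [k hk] : exists k : C, gideal (gens2 c) d (b - k%:M).
    exists (k%:M); split=> //; rewrite -[k%:M]mulr1 scalar_mull.
    have -> : 1 = monomial (fun=> 0%N) by rewrite /monomial big1.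
    exact: mono_spanZ.
  elim: h => {d b} [d|d k|d a b _ [k hk] _ [k' hk']|d m b h _].
  - by exists 0; rewrite raddf0 subr0; exact: gideal0.
  - by exists k; rewrite subrr; exact: gideal0.
  - exists (k + k'); rewrite raddfD /= opprD addrACA; exact: gidealD.
  exists 0; rewrite raddf0 subr0.
  have [k ->] := tau_span (fun n => c n == Some true) m.
  rewrite mulr_suml; apply: gideal_sum => n; rewrite -scale_mull scale_mulr.
  apply: (@gideal_gen _ _ 1); last by rewrite subn1; apply: filtZ.
  have := cs n; case E: (c n) => [[|]|] //= _; [right; left | left]; by exists n.
move=> /andP[ms us] cs.
have cm : c m = None by apply/eqP; rewrite cs mem_head.
have choose_s o : forall n, (set_choice c m (Some o) n == None) = (n \in s).
  move=> n; rewrite /set_choice; case: (eqVneq n m) => [->|nm]; first by rewrite (negPf ms).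
  by rewrite cs inE (negPf nm).
have sub o d e l b : gens2 (set_choice c m (Some o)) e l -> filt (d - e) b ->
    gideal (add_gen (gens2 c) 1 (if o then y m else tau m)) d (l * b).
  move=> Gl; apply: gideal_gen; rewrite /add_gen.
  case: Gl => [[n [cn -> ->]]|[[n [cn -> ->]]|[n [-> ->]]]].
  - move: cn; rewrite /set_choice; case: (eqVneq n m) => [->|nm] cn.
      by case: o cn => // _; right.
    by left; left; exists n.
  - move: cn; rewrite /set_choice; case: (eqVneq n m) => [->|nm] cn.
      by case: o cn => // _; right.
    by left; right; left; exists n.
  - by left; right; right; exists n.
apply: (@covers_mul _ _ _ _ 1 (tau m) 1 (y m) (@homog_gens2 c) (filt_gen m) _ _
  (covers_trans (sub false) (IH _ us (choose_s false)))
  (covers_trans (sub true) (IH _ us (choose_s true)))).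
- move=> d b h; rewrite mulrA (filtC (filt_gen m) (y_deg m)).
  apply: (@gideal_gen _ _ 2); last by rewrite -subnDA in h.
  by right; right; exists m.
- move=> x x' Xx Xx'; apply: mono_spanD.
    by apply: mono_span_leq Xx => n; rewrite /cap2 /set_choice; case: eqP => // ->; rewrite cm.
  apply: mono_span_tau Xx' => n; rewrite /cap2 /set_choice; case: eqP => [->|]; first by rewrite cm.
  by rewrite addn0.
Qed.

(** An undecided [m] is split by [covers_mul], since [tau m * v m] is of lower degree. Once all
    indices are decided, every [y n * tau n] lies in the ideal and the second stage takes over. *)
Lemma covers1 (s : seq 'I_N) c : uniq s -> (forall n, (c n == None) = (n \in s)) ->
  covers (mono_span (cap1 c)) (gens1 c).
Proof.
elim: s c => [|m s IH] c /=.
  (* The second stage reopens exactly the indices where [v n], and not [tau n], was killed. *)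
  move=> _ cs; pose c' n := if c n == Some true then None else Some false.
  have cov := @covers2 (enum (fun n => c n == Some true)) c' (enum_uniq _).
  have {}cov : covers (mono_span (cap2 c')) (gens2 c').
    by apply: cov => n; rewrite mem_enum /c' unfold_in; case: ifP.
  have sub d e l b : gens2 c' e l -> filt (d - e) b -> gideal (gens1 c) d (l * b).
    rewrite /c' => -[[n [cn -> ->]]|[[n [cn _ _]]|[n [-> ->]]]] h.
    - move: cn; case E: (c n) (cs n) => [[|]|] //= _ _.
      by apply: (@gideal_gen _ _ 1) => //; left; exists n.
    - by move: cn; case: ifP.
    have [k ->] := ytau_span (fun n => c n == Some true) n.
    rewrite mulr_suml; apply: gideal_sum => p; rewrite -scale_mull scale_mulr.
    case E: (c p) (cs p) => [[|]|] //= _.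
      by apply: (@gideal_gen _ _ 2); [right; exists p | exact: filtZ].
    rewrite (filtC (y_deg p) (filt_gen p)) -mulrA.
    apply: (@gideal_gen _ _ 1); first by left; exists p.
    (* For [d <= 1] the truncated [d - 2] is 0 and forces [b = 0]. *)
    have [d1|d2] := leqP d 1.
      move: h; rewrite (_ : d - 2 = 0)%N; last by lia.
      by move=> /filt_lt0->; rewrite scaler0 mulr0; exact: filt0.
    rewrite (_ : d - 1 = 1 + (d - 2))%N; last by lia.
    by apply: filtM; [exact: y_deg | exact: filtZ].
  have {}cov := covers_trans sub cov.
  move=> d b /cov[x [Xx h]]; exists x; split=> //.
  apply: mono_span_leq Xx => n; rewrite /cap2 /cap1 /c'.
  by case: (c n) => [[|]|].
move=> /andP[ms us] cs.
have cm : c m = None by apply/eqP; rewrite cs mem_head.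
have choose_s o : forall n, (set_choice c m (Some o) n == None) = (n \in s).
  move=> n; rewrite /set_choice; case: (eqVneq n m) => [->|nm]; first by rewrite (negPf ms).
  by rewrite cs inE (negPf nm).
have sub o d e l b : gens1 (set_choice c m (Some o)) e l -> filt (d - e) b ->
    gideal (add_gen (gens1 c) (if o then 2 else 1) (if o then v m else tau m)) d (l * b).
  move=> Gl; apply: gideal_gen; rewrite /add_gen.
  case: Gl => [[n [cn -> ->]]|[n [cn -> ->]]].
  - move: cn; rewrite /set_choice; case: (eqVneq n m) => [->|nm] cn.
      by case: o cn => // _; right.
    by left; left; exists n.
  - move: cn; rewrite /set_choice; case: (eqVneq n m) => [->|nm] cn.
      by case: o cn => // _; right.
    by left; right; exists n.
apply: (@covers_mul _ _ _ _ 1 (tau m) 2 (v m) (@homog_gens1 c) (filt_gen m) _ _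
  (covers_trans (sub false) (IH _ us (choose_s false)))
  (covers_trans (sub true) (IH _ us (choose_s true)))).
- move=> d b h; rewrite mulrA; apply: gideal_low.
  (* The nominal degree of [tau m * v m] is 3, but [filt 3] means degree at most 2, hence the gain
     of one level. *)
  have [d2|d3] := leqP d 2.
    move: h; rewrite (_ : d - 1 - 2 = 0)%N; last by lia.
    by move=> /filt_lt0->; rewrite mulr0; exact: filt0.
  rewrite (_ : d.-1 = 2 + (d - 1 - 2))%N; last by lia.
  by apply: filtM h; exact: tau_v.
- move=> x x' Xx Xx'; apply: mono_spanD.
    by apply: mono_span_leq Xx => n; rewrite /cap1 /set_choice; case: eqP => // ->; rewrite cm.
  apply: mono_span_tau Xx' => n; rewrite /cap1 /set_choice; case: eqP => [->|]; first by rewrite cm.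
  by rewrite addn0.
Qed.

Lemma filt_mono_span d b : filt d b -> mono_span (fun=> 2%N) b.
Proof.
elim: d b => [|d IH] b; first by move=> /filt_lt0->; exact: mono_span0.
have cov := @covers1 (enum 'I_N) (fun=> None) (enum_uniq _).
have /[apply] := cov _; case=> [n|x [Xx h]]; first by rewrite mem_enum.
rewrite -(subrK x b) addrC; apply: mono_spanD; first exact: mono_span_leq Xx.
(* With no choice made [gens1] is empty, so the ideal contains only elements of lower degree and the
   induction applies to the remainder. *)
apply: IH; have low e a : gideal (gens1 (fun=> None)) e a -> filt e.-1 a.
  elim=> {e a} // [e e' l a [] [n []] //|e a a' _ ha _ ha'].
  exact: filtD.
exact: low h.
Qed.

End Spanning.

(** * The cubic system in an arbitrary commuting family of matrices *)

Section CubicSystem.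
Variables (C : numFieldType) (N D : nat) (eta : C) (K : 'M[C]_3) (xi : 'I_N -> C).
Local Notation A := 'M[C]_D.
Hypothesis eta0 : eta != 0.
Hypothesis xi_gap : forall a b : 'I_N, a != b ->
  forall r : int, (-2 <= r <= 2)%R -> xi a != xi b + r%:~R * eta.

Variable tau : 'I_N -> A.
Hypothesis tau_comm : forall n m, tau n * tau m = tau m * tau n.

Let t1 l : A := (\tr K * \prod_(n < N) (l - xi n))%:M + \sum_n gfun xi n l *: tau n.

Hypothesis tau_cubic : forall a, tau a * ((T2inf eta K xi (xi a - 2%:R * eta))%:M
     + \sum_(n < N) ffun_ eta xi n (xi a - 2%:R * eta) *: (t1 (xi n - eta) * tau n))
  = (qdet eta K xi (xi a - 2%:R * eta))%:M.

Let xinj : injective xi := xi_inj xi_gap.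
Let xgap := xi_gapN xi_gap.

Let lead0 (V : lmodType C) (f : C -> V) (z : 'I_N -> C) : injective z -> polyfun N 0 f ->
  forall l, f l = \sum_(i < N) gfun z i l *: f (z i).
Proof. by move=> zi fd l; rewrite (polyfun_interpolate zi fd) scaler0 add0r. Qed.

Let combination_polyfun (V : lmodType C) (z : 'I_N -> C) (w : 'I_N -> V) :
  polyfun N 0 (fun l => \sum_n gfun z n l *: w n).
Proof.
have := @polyfun_sum _ V N _ (index_enum 'I_N) xpredT _ _ (fun i _ => polyfun_gfun z i (w i)).
by rewrite big1.
Qed.

Let combination_node (V : lmodType C) (z : 'I_N -> C) (w : 'I_N -> V) i : injective z ->
  \sum_n gfun z n (z i) *: w n = w i.
Proof.
move=> zi; rewrite (bigD1 i) //= gfun_node // eqxx scale1r big1 ?addr0 // => n ni.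
by rewrite gfun_node // (negPf ni) scale0r.
Qed.

Let yl l : A := \sum_n gfun xi n l *: tau n.
Let y n := yl (xi n - eta).
Let shift n := xi n - eta.
Let nrm n := \prod_(b < N) (xi n - eta - xi b).
(** Leading part of [T2] divided by the nodal product at the $\xi_b$; [nrm n] is the value of that
    product at $\xi_n-\eta$. *)
Let sl l : A := \sum_n gfun shift n l *: ((nrm n)^-1 *: (y n * tau n)).
Let v n := sl (xi n - 2%:R * eta).

Let filt_lin d (k : 'I_N -> C) w : (forall n, filt tau d (w n)) ->
  filt tau d (\sum_n k n *: w n).
Proof. by move=> hw; apply: filt_sum => n; apply: filtZ. Qed.

Let y_deg n : filt tau 2 (y n).
Proof. by apply: filt_lin => m; apply: filt_gen. Qed.

Let v_deg n : filt tau 3 (v n).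
Proof.
apply: filt_lin => m; apply: filtZ.
exact: (filtM (y_deg m) (filt_gen _ m)).
Qed.

Let shift_inj : injective shift.
Proof. by move=> a b /addIr/xinj. Qed.

(** [yl] has degree less than [N] and takes the values [tau n] at $\xi_n$ and [y n] at $\xi_n-\eta$.
    Picking one of the two points for each [n] gives distinct nodes by the gap condition, and
    interpolation there recovers [yl (xi m)]. *)
Let tau_span (P : pred 'I_N) m : exists k : 'I_N -> C,
  tau m = \sum_n k n *: (if P n then y n else tau n).
Proof.
pose z n := if P n then xi n - eta else xi n.
have zi : injective z.
  move=> a b; rewrite /z; have [//|ab] := eqVneq a b.
  have [g1 g2 _] := xgap ab.
  case: (P a); case: (P b) => e; first exact: shift_inj.
  - by case/eqP: g1; rewrite -e; ring.
  - by case/eqP: g2; rewrite e; ring.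
  - exact: xinj.
exists (fun n => gfun z n (xi m)).
rewrite -[LHS](combination_node tau m xinj) (lead0 zi (combination_polyfun xi tau)).
apply: eq_bigr => n _; congr (_ *: _); rewrite /z /y /yl; case: (P n) => //.
exact: combination_node.
Qed.

(** The same argument for [sl], with the points $\xi_n-2\eta$ and $\xi_n-\eta$. *)
Let ytau_span (P : pred 'I_N) m : exists k : 'I_N -> C,
  y m * tau m = \sum_n k n *: (if P n then v n else y n * tau n).
Proof.
pose z n := if P n then xi n - 2%:R * eta else xi n - eta.
have zi : injective z.
  move=> a b; rewrite /z; have [//|ab] := eqVneq a b.
  have [g1 g2 _] := xgap ab.
  case: (P a); case: (P b) => e.
  - by apply: xinj; apply: addIr e.
  - by case/eqP: g1; rewrite -[xi a](subrK (2 * eta)) e; ring.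
  - by case/eqP: g2; rewrite -[xi a](subrK eta) e; ring.
  - exact: shift_inj.
exists (fun n => nrm m * gfun z n (shift m) * (if P n then 1 else (nrm n)^-1)).
have slm n : sl (shift n) = (nrm n)^-1 *: (y n * tau n) by exact: combination_node.
have -> : y m * tau m = nrm m *: sl (shift m).
  by rewrite slm scalerA mulfV ?scale1r //; apply: prod_shift_neq0.
rewrite (lead0 zi (combination_polyfun _ _ : polyfun N 0 sl)) scaler_sumr; apply: eq_bigr => n _.
rewrite -!scalerA; congr (_ *: (_ *: _)); rewrite /z; case: (P n).
  by rewrite scale1r.
exact: slm.
Qed.

(** Up to the nonzero factor [p], [tau n * v n] is the cubic part of the relation [tau_cubic], whose
    other terms have degree at most 2. *)
Let tau_v n : filt tau 3 (tau n * v n).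
Proof.
pose l := xi n - 2%:R * eta; pose p := \prod_(b < N) (l - xi b).
have p0 : p != 0.
  apply/prodf_neq0 => b _; rewrite subr_eq0 subr_eq addrC -subr_eq.
  have [->|nb] := eqVneq n b; last by have [] := xgap nb.
  by rewrite subrr eq_sym mulf_neq0 // pnatr_eq0.
rewrite -[_ * _]scale1r -(mulVf p0) -scalerA; apply: filtZ.
have t1E m : t1 (xi m - eta) * tau m =
   (\tr K * \prod_(b < N) (xi m - eta - xi b)) *: tau m + y m * tau m.
  by rewrite /t1 mulrDl scalar_mull.
have low k : filt tau 3 (k *: tau n).
  by apply: filtZ; apply: filt_leq (filt_gen _ n).
have -> : p *: (tau n * v n) = (qdet eta K xi l)%:M - (T2inf eta K xi l *: tau n
    + \sum_m ffun_ eta xi m l *: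
        ((\tr K * \prod_(b < N) (xi m - eta - xi b)) *: (tau n * tau m))).
  apply/eqP; rewrite eq_sym subr_eq eq_sym -tau_cubic mulrDr scalar_mulr addrCA.
  apply/eqP; congr (_ + _); rewrite !mulr_sumr scaler_sumr -big_split.
  apply: eq_bigr => m _ /=; rewrite t1E -!scale_mulr mulrDr scalerDr addrC.
  rewrite -scale_mulr; congr (_ + _); rewrite !scalerA; congr (_ *: _).
  by rewrite ffun__gfunE -/p; ring.
apply: filtD; first exact: filt_scalar.
rewrite -scaleN1r; apply: filtZ; apply: filtD => //.
apply: filt_lin => m; apply: filtZ.
exact: (filtM (filt_gen _ n) (filt_gen _ m)).
Qed.

Lemma cubic_mono_span d b : filt tau d b -> mono_span tau (fun=> 2%N) b.
Proof. exact: (filt_mono_span tau_comm y_deg v_deg tau_v tau_span ytau_span). Qed.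
End CubicSystem.

(** * Spectrum *)

Section ScalarExtension.
Variables (C : numFieldType) (D : nat).

Definition ext_mx (M : 'M[C]_D) (c : C) : 'M[C]_(D + 1) := block_mx M 0 0 c%:M.

Lemma ext_mxM M M' c c' : ext_mx M c * ext_mx M' c' = ext_mx (M * M') (c * c').
Proof.
rewrite [LHS]mulmx_block !mulmx0 !mul0mx !addr0 !add0r.
by rewrite -scalar_mxM.
Qed.

Lemma ext_mxD M M' c c' : ext_mx M c + ext_mx M' c' = ext_mx (M + M') (c + c').
Proof. by rewrite /ext_mx add_block_mx !addr0 raddfD. Qed.

Lemma ext_mxZ a M c : a *: ext_mx M c = ext_mx (a *: M) (a * c).
Proof. by rewrite /ext_mx scale_block_mx !scaler0 scale_scalar_mx. Qed.

Lemma ext_mx_scalar c : ext_mx c%:M c = c%:M.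
Proof. by rewrite /ext_mx -scalar_mx_block. Qed.

Lemma ext_mx0 : ext_mx 0 0 = 0.
Proof. by rewrite -(raddf0 (@scalar_mx C D)) ext_mx_scalar raddf0. Qed.

Lemma ext_mx_sum (I : Type) (s : seq I) (M : I -> 'M[C]_D) (c : I -> C) :
  \sum_(i <- s) ext_mx (M i) (c i) = ext_mx (\sum_(i <- s) M i) (\sum_(i <- s) c i).
Proof.
elim: s => [|i s IH]; first by rewrite !big_nil ext_mx0.
by rewrite !big_cons IH ext_mxD.
Qed.

Lemma ext_mx_monomial N (M : 'I_N -> 'M[C]_D) (c : 'I_N -> C) h :
  monomial (fun n => ext_mx (M n) (c n)) h
  = ext_mx (monomial M h) (\prod_(n < N) c n ^+ h n).
Proof.
have pow n k : ext_mx (M n) (c n) ^+ k = ext_mx (M n ^+ k) (c n ^+ k).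
  elim: k => [|k IH]; first by rewrite !expr0 ext_mx_scalar.
  by rewrite !exprS IH ext_mxM.
rewrite /monomial; elim: (index_enum _) => [|n s IH].
  by rewrite !big_nil ext_mx_scalar.
by rewrite !big_cons IH pow ext_mxM.
Qed.

Lemma ext_mx_inj M M' c c' : ext_mx M c = ext_mx M' c' -> M = M' /\ c = c'.
Proof.
move=> /eq_block_mx[-> _ _ /matrixP/(_ 0 0)]; rewrite !mxE eqxx !mulr1n.
by [].
Qed.
End ScalarExtension.

Section Spectrum.
Variables (C : numFieldType) (N : nat) (eta : C) (K : 'M[C]_3) (xi : 'I_N -> C).
Variable S : 'rV[C]_(Hdim N).
Hypothesis N_gt0 : (0 < N)%N.
Hypothesis xi_gap : forall a b : 'I_N, a != b ->
  forall r : int, (-2 <= r <= 2)%R -> xi a != xi b + r%:~R * eta.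
Hypothesis S_basis : hmx eta K xi S \in unitmx.

Local Notation T := (T1 eta K xi).
Local Notation H := (hmx eta K xi S).

Lemma hvecE h : hvec eta K xi S h = S *m monomial (fun n => T (xi n)) (fun n => h n).
Proof. by []. Qed.

Lemma row_hmx h : row (enum_rank h) H = hvec eta K xi S h.
Proof. by rewrite /hmx rowK /cfg enum_rankK. Qed.

(** For $\eta=0$ the factor at site [a] vanishes at $\xi_a$, so every [T (xi a)] is 0 and the
    covector with all exponents 1 is a zero row of the basis matrix. *)
Lemma eta_neq0 : eta != 0.
Proof.
apply/eqP => e0.
have T0 a : T (xi a) = 0.
  have [s1 [s2 [_ E]]] := monodromy_split eta K xi a.
  rewrite T1E E (_ : site _ _ _ = 0) ?mulr0 ?mul0r ?raddf0 //.
  by apply/matrixP => i j; rewrite !mxE subrr mul0r e0 scale0r addr0 raddf0.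
pose h : cfgT N := [ffun=> 1].
have h0 : hvec eta K xi S h = 0.
  have : (0 < size (index_enum 'I_N))%N.
    by rewrite [index_enum _]unlock -enumT size_enum_ord.
  rewrite /hvec; case: (index_enum _) => // n s _.
  by rewrite big_cons ffunE expr1 T0 mul0r mulmx0.
have : delta_mx 0 (enum_rank h) = 0 :> 'rV[C]_(Hdim N).
  by rewrite -[LHS](mulmxK S_basis) -rowE row_hmx h0 mul0mx.
move=> /matrixP/(_ 0 (enum_rank h)).
by rewrite !mxE !eqxx => /eqP; rewrite oner_eq0.
Qed.

Lemma eigen_monomial t v h : is_common_eigvec T t v ->
  monomial (fun n => T (xi n)) h *m v = (\prod_(n < N) t (xi n) ^+ h n) *: v.
Proof.
move=> [_ Tv]; have pow n k : T (xi n) ^+ k *m v = t (xi n) ^+ k *: v.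
  elim: k => [|k IH]; first by rewrite !expr0 mul1mx scale1r.
  by rewrite !exprSr -mulmxA Tv -scalemxAr IH scalerA mulrC.
rewrite /monomial; elim: (index_enum _) => [|n s IH].
  by rewrite !big_nil mul1mx scale1r.
by rewrite !big_cons -mulmxA IH -scalemxAr pow scalerA mulrC.
Qed.

Lemma eigen_hvec t v h : is_common_eigvec T t v ->
  hvec eta K xi S h *m v = (\prod_(n < N) t (xi n) ^+ h n) *: (S *m v).
Proof. by move=> tv; rewrite hvecE -mulmxA (eigen_monomial _ tv) -scalemxAr. Qed.

Lemma hmx_ext (v w : 'cV[C]_(Hdim N)) :
  (forall h, hvec eta K xi S h *m v = hvec eta K xi S h *m w) -> v = w.
Proof.
move=> hvw; rewrite -[v]mul1mx -[w]mul1mx -(mulVmx S_basis) -!mulmxA; congr (_ *m _).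
apply/row_matrixP => i; rewrite !row_mul -(enum_valK i) row_hmx; exact: hvw.
Qed.

(** All coordinates of [v] in the basis are multiples of [S *m v]. *)
Lemma eigen_S_neq0 t v : is_common_eigvec T t v -> (S *m v) 0 0 != 0.
Proof.
move=> tv; case: (tv) => v0 _; apply: contraNneq v0 => Sv; apply/eqP/hmx_ext => h.
by rewrite (eigen_hvec _ tv) mulmx0 [S *m v]mx11_scalar Sv raddf0 scaler0.
Qed.

(** The coordinates of an eigenvector are fixed by [t] up to the common factor [S *m v]. *)
Lemma T1_wsimple : wsimple_family T.
Proof.
move=> t v w tv tw; exists ((S *m w) 0 0 / (S *m v) 0 0); apply: hmx_ext => h.
rewrite -scalemxAr (eigen_hvec _ tv) (eigen_hvec _ tw) scalerA mulrC -scalerA.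
congr (_ *: _); move: (S *m v) (S *m w) (eigen_S_neq0 tv) => a b a0.
by apply/matrixP => i j; rewrite !ord1 !mxE divfK.
Qed.

Lemma eigen_normalized t : family_eigenvalue T t ->
  exists v, is_common_eigvec T t v /\
    forall h : cfgT N, (hvec eta K xi S h *m v) 0 0 = \prod_(n < N) t (xi n) ^+ h n.
Proof.
move=> [v tv]; have s0 := eigen_S_neq0 tv; have [v0 Tv] := tv.
exists (((S *m v) 0 0)^-1 *: v); split.
  split=> [|l]; first by rewrite scaler_eq0 invr_eq0 negb_or s0.
  by rewrite -scalemxAr Tv !scalerA mulrC.
move=> h; rewrite -scalemxAr (eigen_hvec _ tv).
move: (S *m v) s0 => a a0; rewrite !mxE mulrCA mulVf ?mulr1 //.
Qed.

Hypothesis eta0 : eta != 0.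

Lemma eigen_t1of t v : is_common_eigvec T t v ->
  forall l, t l = t1of K xi (fun a => t (xi a)) l.
Proof.
move=> [v0 Tv] l; apply/eqP; rewrite -subr_eq0.
suff : (t l - t1of K xi (fun a => t (xi a)) l) *: v = 0.
  by move/eqP; rewrite scaler_eq0 (negPf v0) orbF.
rewrite scalerBl -Tv (T1_interpolate K xi_gap) mulmxDl -scalemxAl mul_scalar_mx.
rewrite mulmx_suml scalerDl [X in _ - (_ + X)]scaler_suml scalerA mulrC opprD addrACA subrr add0r.
apply/eqP; rewrite subr_eq0; apply/eqP/eq_bigr => n _.
by rewrite -scalemxAl Tv scalerA.
Qed.

(** The operator identity [T1_cubic] is applied to the eigenvector. *)
Lemma eigen_SigmaT t v : is_common_eigvec T t v ->
  in_SigmaT eta K xi (fun a => t (xi a)).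
Proof.
move=> tv a; have [v0 Tv] := tv; apply/eqP; rewrite -subr_eq0.
match goal with |- is_true (?x == 0) => suff : x *: v = 0 end.
  by move/eqP; rewrite scaler_eq0 (negPf v0) orbF.
rewrite scalerBl -[qdet _ _ _ _ *: v]mul_scalar_mx -(T1_cubic K eta0 xi_gap).
rewrite -mulmxA mulmxDl mul_scalar_mx; apply/eqP; rewrite subr_eq0; apply/eqP.
have -> : (\sum_i ffun_ eta xi i (xi a - 2 * eta) *: (T (xi i - eta) * T (xi i))) *m v
   = (\sum_(n < N) ffun_ eta xi n (xi a - 2 * eta)
        * t1of K xi (fun b => t (xi b)) (xi n - eta) * t (xi n)) *: v.
  rewrite mulmx_suml scaler_suml; apply: eq_bigr => n _; rewrite -scalemxAl -mulmxA Tv.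
  by rewrite -scalemxAr Tv !scalerA -(eigen_t1of tv) mulrAC.
by rewrite -scalerDl -scalemxAr Tv scalerA mulrC.
Qed.

(** * From a solution of the cubic system to an eigenvector *)

Section Converse.
Variable x : 'I_N -> C.
Hypothesis xS : in_SigmaT eta K xi x.

(* The span of the vectors [(<h|, \prod_n x_n ^ h_n)] is stable under the matrices
   [tau n] by [cubic_mono_span]; being the graph of the functional [v], it forces
   multiplication by [T (xi n)] to be multiplication by [x n] on [v]. *)
Let tau n := ext_mx (T (xi n)) (x n).
Let v : 'cV[C]_(Hdim N) :=
  invmx H *m \col_i \prod_(n < N) x n ^+ cfg i n.

Lemma hvec_SoV h : hvec eta K xi S h *m v = (\prod_(n < N) x n ^+ h n)%:M.
Proof.
rewrite -row_hmx -row_mul mulKVmx //; apply/matrixP => i j.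
by rewrite !mxE !ord1 eqxx mulr1n /cfg enum_rankK.
Qed.

(** The pairs satisfy the cubic system componentwise: the matrices by [T1_cubic], the scalars by
    [xS]. *)
Lemma tau_mono_span d b : filt tau d b -> mono_span tau (fun=> 2%N) b.
Proof.
apply: (cubic_mono_span (K := K) eta0 xi_gap).
  by move=> n m; rewrite /tau !ext_mxM (T1_comm K xi_gap) mulrC.
move=> a; pose t l := t1of K xi x l.
have tE l : (\tr K * \prod_(n < N) (l - xi n))%:M + \sum_n gfun xi n l *: tau n
    = ext_mx (T l) (t l).
  have -> : \sum_n gfun xi n l *: tau n
      = ext_mx (\sum_n gfun xi n l *: T (xi n)) (\sum_n gfun xi n l * x n).
    by rewrite -ext_mx_sum; apply: eq_bigr => n _; rewrite -ext_mxZ.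
  rewrite -ext_mx_scalar ext_mxD (T1_interpolate K xi_gap).
  by rewrite scale_scalar_mx [_ * \tr K]mulrC.
under eq_bigr => n _ do rewrite tE /tau ext_mxM ext_mxZ.
rewrite /tau ext_mx_sum -!ext_mx_scalar ext_mxD ext_mxM; congr ext_mx.
  exact: (T1_cubic K eta0 xi_gap).
by rewrite -xS; congr (_ * (_ + _)); apply: eq_bigr => n _; rewrite mulrA.
Qed.

Lemma mono_span_graph b : mono_span tau (fun=> 2%N) b ->
  exists M c, b = ext_mx M c /\ S *m M *m v = c%:M.
Proof.
elim=> {b} [|c h h2|a b _ [M [c [-> hc]]] _ [M' [c' [-> hc']]]].
- by exists 0, 0; rewrite ext_mx0 mulmx0 mul0mx raddf0.
(* Exponents at most 2 are read as a configuration, where [hvec_SoV] gives the graph relation. *)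
- pose k : cfgT N := [ffun n => inord (h n)].
  have kh n : k n = h n :> nat by rewrite ffunE inordK // ltnS.
  exists (c *: monomial (fun n => T (xi n)) h), (c * \prod_(n < N) x n ^+ h n).
  split; first by rewrite ext_mx_monomial ext_mxZ.
  rewrite -scalemxAr -scalemxAl.
  have -> : monomial (fun n => T (xi n)) h = monomial (fun n => T (xi n)) (fun n => k n).
    by apply: eq_bigr => n _; rewrite kh.
  rewrite -hvecE hvec_SoV scale_scalar_mx; congr (_ * _)%:M.
  by apply: eq_bigr => n _; rewrite kh.
- exists (M + M'), (c + c'); split; first exact: ext_mxD.
  by rewrite mulmxDr mulmxDl hc hc' raddfD.
Qed.

Lemma T1_node_SoV a : T (xi a) *m v = x a *: v.
Proof.
apply: hmx_ext => h; rewrite -scalemxAr hvec_SoV scale_scalar_mx.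
have mono_filt : exists d, filt tau d (monomial tau (fun n => h n)).
  have pow n k d b : filt tau d b -> exists d', filt tau d' (tau n ^+ k * b).
    elim: k => [|k IH] hb; first by exists d; rewrite mul1r.
    have [d' hd'] := IH hb; exists d'.+1; rewrite exprS -mulrA; exact: filt_tau.
  rewrite /monomial; elim: (index_enum _) => [|n s [d hd]].
    by exists 1%N; rewrite big_nil; exact: filt_scalar.
  by have [d' hd'] := pow n (h n) _ _ hd; exists d'; rewrite big_cons.
have [d hd] := mono_filt.
(* Multiplying a basis monomial by [tau a] stays in the graph; comparing the two blocks identifies
   [M] and [c]. *)
have [M [c [E hc]]] := mono_span_graph (tau_mono_span (filt_tau a hd)).
move: E; rewrite ext_mx_monomial ext_mxM => /ext_mx_inj[ME cE].
rewrite cE -hc -ME hvecE.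
have -> : T (xi a) * monomial (fun n => T (xi n)) (fun n => h n)
    = monomial (fun n => T (xi n)) (fun n => h n) * T (xi a).
  by apply: commr_prod => n _; apply: commrX; apply: (T1_comm K xi_gap).
by rewrite !mulmxA.
Qed.

Lemma SigmaT_eigen : is_common_eigvec T (t1of K xi x) v.
Proof.
split=> [|l].
  (* The coordinate with all exponents 0 equals 1, so [v] is nonzero. *)
  apply/eqP => v0; have := hvec_SoV [ffun=> 0]; rewrite v0 mulmx0 => /matrixP/(_ 0 0).
  rewrite !mxE eqxx mulr1n big1 => [/eqP|n _]; first by rewrite eq_sym oner_eq0.
  by rewrite ffunE.
rewrite (T1_interpolate K xi_gap) mulmxDl -scalemxAl mul_scalar_mx scalerA.
rewrite mulmx_suml scalerDl scaler_suml mulrC; congr (_ + _).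
by apply: eq_bigr => n _; rewrite -scalemxAl T1_node_SoV scalerA.
Qed.
End Converse.
End Spectrum.

Local Open Scope complex_scope.

Theorem theorem5p1 (R : realType) (N : nat) (eta : R[i]) (K : 'M[R[i]]_3)
  (xi : 'I_N -> R[i]) (S : 'rV[R[i]]_(Hdim N)) :
  (0 < N)%N ->
  wsimple_mx K ->
  (forall a b : 'I_N, a != b ->
     forall r : int, (-2 <= r <= 2)%R -> xi a != xi b + r%:~R * eta) ->
  row_free (hmx eta K xi S) && row_full (hmx eta K xi S) ->
  [/\ (forall t : R[i] -> R[i],
         family_eigenvalue (T1 eta K xi) t <->
         exists x : 'I_N -> R[i],
           in_SigmaT eta K xi x /\ forall l, t l = t1of K xi x l),
      wsimple_family (T1 eta K xi)
    & forall t : R[i] -> R[i], family_eigenvalue (T1 eta K xi) t ->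
        exists v, is_common_eigvec (T1 eta K xi) t v /\
          forall h : cfgT N,
            (hvec eta K xi S h *m v) 0 0 = \prod_(n < N) t (xi n) ^+ h n].
Proof.
move=> N0 _ gap /andP[]; rewrite row_free_unit => basis _.
have e0 := eta_neq0 N0 basis.
split.
- move=> t; split=> [[v tv]|[x [xS tE]]].
    exists (fun a => t (xi a)); split; first exact: (eigen_SigmaT gap e0 tv).
    exact: (eigen_t1of gap tv).
  have [v0 Tv] := SigmaT_eigen gap basis e0 xS.
  exists (invmx (hmx eta K xi S) *m \col_i \prod_(n < N) x n ^+ cfg i n).
  by split=> // l; rewrite Tv tE.
- exact: (T1_wsimple basis).
- exact: (eigen_normalized basis).
Qed.
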